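(* Let $G$ be the Klein four-group, let $\Bbbk$ be a field of characteristic $2$, and let $\chi$ be the set of the three subgroups of order $2$ of $G$. Let $M$ be an indecomposable $\Bbbk G$-module which is not projective relative to $\chi$. Then $\Omega_{\chi}(M) \cong \Omega^{-2}(M)$ if $M$ has odd dimension, and $\Omega_{\chi}(M) \cong M$ otherwise.
   Context: All modules are finitely generated. Write $G = \langle \sigma,\tau\rangle$, and $\chi=\{H_1,H_2,H_3\}$ with $H_1=\langle\sigma\rangle$, $H_2=\langle\tau\rangle$, $H_3=\langle\sigma\tau\rangle$. The field $\Bbbk$ is not assumed algebraically closed. A $\Bbbk G$-module $M$ is projective relative to $\chi$ if it is a direct summand of $\bigoplus_{H\in\chi} M\downarrow_H\uparrow^G$. A $\Bbbk G$-homomorphism is $\chi$-split if it splits on restriction to each $H\in\chi$. The relative projective cover of $M$ is the pair $(Q_0,\pi_0)$ with $Q_0$ a $\Bbbk G$-module of smallest possible dimension such that $Q_0$ is projective relative to $\chi$ and $\pi_0:Q_0\to M$ is a surjective $\chi$-split $\Bbbk G$-homomorphism; it exists and its kernel, denoted $\Omega_\chi(M)$, is unique up to isomorphism. $\Omega^{-1}(M)$ denotes the cokernel of the (ordinary) injective hull $M\to J$ of $M$ as a $\Bbbk G$-module, and $\Omega^{-2}(M)=\Omega^{-1}(\Omega^{-1}(M))$. *)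

(* Defs.v *)
From HB Require Import structures.
From mathcomp Require Import all_boot all_order all_algebra all_fingroup.
From mathcomp Require Import all_solvable all_character.

Set Implicit Arguments.
Unset Strict Implicit.
Unset Printing Implicit Defensive.

Import GroupScope GRing.Theory.
Local Open Scope ring_scope.

(* A finitely generated kG-module is a matrix representation
   [M : representation k G]. MathComp represents group elements by matrices
   acting on row vectors on the right, so a map A -> B is a matrix f acting by
   v |-> v *m f: it is injective iff [row_free f], surjective iff [row_full f],
   with image the row space of f and kernel the row space of [kermx f].
   Isomorphism is [mx_rsim], direct sum is [dadd_grepr]. *)

Section Modules.

Variables (k : fieldType) (gT : finGroupType) (G : {group gT}).
Implicit Types M N A B J Q : representation k G.

Record hom A B := Hom {
  hom_mx :> 'M[k]_(rdegree A, rdegree B);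
  hom_comm : {in G, forall x, A x *m hom_mx = hom_mx *m B x} }.

Lemma ker_module A B (f : hom A B) : mxmodule A (kermx f).
Proof.
apply/mxmoduleP => x Gx; apply/sub_kermxP.
by rewrite -mulmxA hom_comm // mulmxA mulmx_ker mul0mx.
Qed.

Lemma im_module A B (f : hom A B) : mxmodule B <<f>>%MS.
Proof.
apply/mxmoduleP => x Gx.
by rewrite (eqmxMr _ (genmxE f)) genmxE -hom_comm // submxMl.
Qed.

Definition ker_repr A B (f : hom A B) : representation k G :=
  Representation (submod_repr (ker_module f)).

Definition coker_repr A B (f : hom A B) : representation k G :=
  Representation (factmod_repr (im_module f)).

Definition direct_summand A M :=
  exists B, mx_rsim M (dadd_grepr A B).

Definition indecomposable M :=
  (0 < rdegree M)%N /\
  forall A B, mx_rsim M (dadd_grepr A B) -> rdegree A = 0 \/ rdegree B = 0.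

(* Injectivity in the category of finitely generated modules, which by Baer's
   criterion is injectivity as a kG-module. *)
Definition injective_module J :=
  forall A B (i : hom A B) (f : hom A J), row_free i ->
  exists g : hom B J, i *m g = f.

Definition essential M J (i : hom M J) :=
  forall U : 'M[k]_(rdegree J), mxmodule J U -> U != 0 -> (U :&: i)%MS != 0.

Record injective_hull M := InjectiveHull {
  hull : representation k G;
  hull_map : hom M hull;
  hull_map_inj : row_free hull_map;
  hull_injective : injective_module hull;
  hull_essential : essential hull_map }.

Definition cosyzygy M (J : injective_hull M) : representation k G :=
  coker_repr (hull_map J).

End Modules.

Definition subgroup_of (gT : finGroupType) (G : {group gT}) :=
  {H : {group gT} | H \subset G}.

Section Induction.

Variables (k : fieldType) (gT : finGroupType) (G : {group gT}).
Variable H : subgroup_of G.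

Definition restriction (M : representation k G) : representation k (val H) :=
  Representation (subg_repr M (valP H)).

Variable W : representation k (val H).

(* The basis of the induced module W (x)_kH kG is given by the w_a (x) t_i, for
   (w_a) the basis of W and (t_i) a right transversal of H in G; since
   t_i x = h t_j with h in H exactly when t_i x t_j^-1 is in H, the element x
   maps w (x) t_i to w h (x) t_j for the j with h = t_i x t_j^-1 in H. *)
Definition coset_rep (i : 'I_#|G : val H|) : gT :=
  repr (enum_val i : {set gT}).

Definition induced_mx (x : gT) :=
  \mxblock_(i < #|G : val H|, j < #|G : val H|)
    (let h := (coset_rep i * x * (coset_rep j)^-1)%g in
     if h \in val H then W h else 0 : 'M[k]_(rdegree W)).

Lemma coset_repP i : coset_rep i \in G /\ enum_val i = val H :* coset_rep i.
Proof.
rewrite /coset_rep; case/rcosetsP: (enum_valP i) => x Gx ->.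
split; last by rewrite rcoset_repr.
by apply: (subsetP (mul_subG (valP H) _)) (mem_repr_rcoset _ x); rewrite sub1set.
Qed.

Lemma coset_rep_inj i j :
  (coset_rep i * (coset_rep j)^-1)%g \in val H -> i = j.
Proof.
move=> ijH; apply: enum_val_inj.
have [[_ ->] [_ ->]] := (coset_repP i, coset_repP j).
by apply/rcoset_eqP; rewrite mem_rcoset.
Qed.

Lemma coset_rep_exists x : x \in G ->
  exists j, (x * (coset_rep j)^-1)%g \in val H.
Proof.
move=> Gx; have xR : val H :* x \in rcosets (val H) G by apply/rcosetsP; exists x.
exists (enum_rank_in xR (val H :* x)).
rewrite -mem_rcoset.
by case: (coset_repP (enum_rank_in xR (val H :* x))) => _ <-;
  rewrite enum_rankK_in ?rcoset_refl.
Qed.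

Lemma induced_mx_repr : mx_repr G induced_mx.
Proof.
split=> [|x y Gx Gy].
  rewrite -mxdiagZ /induced_mx; apply/eq_mxblockP => i j /=.
  rewrite mulg1; have [<-|ne_ij] := eqVneq i j.
    by rewrite mulgV group1 repr_mx1 conform_mx_id.
  by case: ifP => // /coset_rep_inj/eqP; rewrite (negPf ne_ij).
rewrite /induced_mx mul_mxblock; apply/eq_mxblockP => i l /=.
have Gi := (coset_repP i).1.
have [j Hj] := coset_rep_exists (groupM Gi Gx).
rewrite (bigD1 j) //= Hj big1 ?addr0 => [|j' ne_j'].
  have -> : (coset_rep i * (x * y) * (coset_rep l)^-1 =
     (coset_rep i * x * (coset_rep j)^-1)
     * (coset_rep j * y * (coset_rep l)^-1))%g by rewrite !mulgA mulgKV.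
  rewrite groupMl //; case: ifP => [Hl|_]; last by rewrite mulmx0.
  by rewrite repr_mxM.
case: ifP => [Hj'|_]; last by rewrite mul0mx.
case/eqP: ne_j'; apply: coset_rep_inj.
have -> : (coset_rep j' * (coset_rep j)^-1 =
   (coset_rep i * x * (coset_rep j')^-1)^-1
   * (coset_rep i * x * (coset_rep j)^-1))%g.
  by rewrite !invMg invgK -!mulgA !mulKg.
by rewrite groupM ?groupV.
Qed.

Definition induced : representation k G :=
  Representation (MxRepresentation induced_mx_repr).

End Induction.

Section RelativeProjectivity.

Variables (k : fieldType) (gT : finGroupType) (G : {group gT}).
Variable chi : {set subgroup_of G}.
Implicit Types M N Q : representation k G.

Definition rel_projective M :=
  direct_summand M
    (\big[dadd_grepr/grepr0]_(H in chi) induced (restriction H M)).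

(* For a surjective f, as in the definition of covers below. *)
Definition rel_split M N (f : hom M N) :=
  forall H, H \in chi ->
  exists s : hom (restriction H N) (restriction H M), s *m f = 1%:M.

Record rel_projective_cover M := RelProjectiveCover {
  cover : representation k G;
  cover_map : hom cover M;
  cover_projective : rel_projective cover;
  cover_surjective : row_full cover_map;
  cover_split : rel_split cover_map;
  cover_minimal : forall Q (f : hom Q M),
    rel_projective Q -> row_full f -> rel_split f ->
    (rdegree cover <= rdegree Q)%N }.

Definition rel_syzygy M (Q : rel_projective_cover M) : representation k G :=
  ker_repr (cover_map Q).

End RelativeProjectivity.

Definition subgroups_of_order2 (gT : finGroupType) (G : {group gT})
    : {set subgroup_of G} :=
  [set H : subgroup_of G | #|val H| == 2].

(* Main.v *)
Require Import Defs.
From mathcomp Require Import all_boot all_order all_algebra all_fingroup.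
From mathcomp Require Import all_solvable all_character.

Set Implicit Arguments.
Unset Strict Implicit.
Unset Printing Implicit Defensive.

Import Defs.
Import GroupScope GRing.Theory.
Local Open Scope ring_scope.

(** Let G = <s, t>, let K be the kernel of the given cover Q -> M, and let A be
    a second cosyzygy of M, the cokernel of N -> J1 for exact sequences
    M -> J0 -> N and N -> J1 -> A with J0 and J1 injective.

    The core of the proof is that K is isomorphic to A for every
    indecomposable M that is not projective relative to the order 2 subgroups,
    provided A has no idempotent endomorphism besides 0 and 1
    ([syzygy_iso]).  In cohomological terms, each of the three subgroups H is
    the kernel of a class c_H in H^1(G, F_2), and Q is the extension of M by K
    given by a class in Ext^1(M, K) that restricts to zero on each H.  A class in Tate cohomology that vanishes
    on H is divisible by c_H, and c_H is invertible on the other two subgroups,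
    so a quotient by c_H still vanishes on them.  Hence the class of Q is
    divisible by the product of the three c_H, and the quotient has degree -2:
    it is a map f : A -> K ([divide], used once for each of two subgroups, and
    the splitting over the third one).  Thus Q receives a map, over M, from the
    extension Q'' of M by A that is defined by the product of the c_H.  That
    product vanishes on each H, so Q'' -> M splits over each H, and relative
    projectivity of Q gives a map Q -> Q'' over M.  The composite Q -> Q'' -> Q
    is an endomorphism over M, hence invertible because the cover has minimal
    dimension and by Fitting's lemma.  On kernels this makes K a direct summand
    of A ([syzygy_retract]), and a nonzero one since otherwise M would be
    isomorphic to Q.

    All of this is done with explicit traces.  The relation between a map and
    its conjugates replaces cohomology: a map is stably trivial on a subgroup
    when it is a trace from the trivial subgroup, and relative projectivity
    is Higman's criterion, that the identity is a sum of traces of maps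
    commuting with the subgroups ([rel_projective_chi_projective],
    [injective_projective]).

    For odd dimension, A is the cosyzygy of the cosyzygy of M, and it has only
    trivial idempotents because passing to a cosyzygy preserves this property
    ([idem_trivial_cosyzygy]).

    For even dimension, M itself is a second cosyzygy of M.  Since M is
    indecomposable and not projective, the products of two elements of the
    augmentation ideal act as zero, so that M is a pencil of two linear maps
    from its top to its radical.  By part of Kronecker's classification, proved
    here with reflections and a Fitting decomposition ([pencil_even]), one of
    the two maps is bijective.  This says that M is free over <s> or over
    <t>, and then inducing its restriction to that subgroup back up to G gives
    a free module which is an extension of M by M ([ext_exact],
    [ext_projective]). *)

(** * Pencils of linear maps *)
Section Pencils.
Variable k : fieldType.

(** Having only trivial idempotents is what indecomposability of the Kronecker
    module given by P and R means, except that the zero module is included. *)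
Definition pencil_indec v w (P R : 'M[k]_(v, w)) := forall a b,
  a *m a = a -> b *m b = b -> a *m P = P *m b -> a *m R = R *m b ->
  (a = 0 /\ b = 0) \/ (a = 1%:M /\ b = 1%:M).

Lemma row_dual n (u : 'rV[k]_n) : u != 0 -> exists la : 'cV[k]_n, u *m la = 1%:M.
Proof.
move=> u_neq0; have [j uj] : exists j, u 0 j != 0.
  apply/existsP; rewrite -negb_forall; apply: contra u_neq0 => /forallP u0.
  by apply/eqP/rowP => j; rewrite mxE; apply/eqP/u0.
exists ((u 0 j)^-1 *: delta_mx j 0); rewrite -scalemxAr -colE.
by apply/matrixP => a b; rewrite !ord1 !mxE mulVf.
Qed.

Lemma scalar_mx_eq0 n : (0 : 'M[k]_n) = 1%:M -> n = 0%N.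
Proof. by move=> e01; rewrite -(mxrank1 k n) -e01 mxrank0. Qed.

(** A vector killed by both maps spans a direct summand with dimensions (1, 0),
    which would be the whole pencil; but 1 + 0 is odd. *)
Lemma pencil_common_kernel v w (P R : 'M[k]_(v, w)) :
  pencil_indec P R -> ~~ odd (v + w) -> row_free (row_mx P R).
Proof.
move=> PR_indec even; rewrite -kermx_eq0; apply/negPn/negP => /rowV0Pn[u].
move/sub_kermxP; rewrite mul_mx_row -[0](@row_mx0 _ 1 w w) => /eq_row_mx[uP uR].
move=> u_neq0; have [la ula] := row_dual u_neq0.
have [||||[a0 _]|[a1 b1]] := PR_indec (la *m u) 0.
- by rewrite -mulmxA (mulmxA u) ula mul1mx.
- exact: mulmx0.
- by rewrite mulmx0 -mulmxA uP mulmx0.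
- by rewrite mulmx0 -mulmxA uR mulmx0.
- by case/eqP: u_neq0; rewrite -[u]mul1mx -ula -mulmxA a0 mulmx0.
have w0 := scalar_mx_eq0 b1; have v_le1 : (v <= 1)%N.
  rewrite -(mxrank1 k v) -a1 (leq_trans (mxrankM_maxr _ _)) //; exact: rank_leq_row.
have v_neq0 : v != 0%N.
  apply: contra u_neq0 => /eqP v0; apply/eqP/rowP => j.
  have := leq_ltn_trans (leq0n j) (ltn_ord j).
  by rewrite [X in (_ < X)%N]v0.
by move: even; rewrite w0 addn0; case: (v) v_le1 v_neq0 => [|[]].
Qed.

(** The reflection functor: (P', R') is the cokernel of the injection
    (P, R) : k^v -> k^w + k^w, up to the order and the sign of the components.
    An endomorphism of (P', R') doubles to one of k^w + k^w that preserves the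
    image of k^v, so it comes from an endomorphism of (P, R). *)
Lemma pencil_reflection v w (P R : 'M[k]_(v, w)) :
  pencil_indec P R -> row_free (row_mx P R) ->
  exists c, exists P' : 'M[k]_(w, c), exists R' : 'M[k]_(w, c),
  [/\ (w + w = v + c)%N, P *m R' = R *m P' & pencil_indec P' R'].
Proof.
move=> PR_indec PRfree; set A := row_mx P R in PRfree.
pose C := col_base (cokermx A).
have AC : A *m C = 0.
  apply: (row_free_inj (row_base_free (cokermx A))).
  by rewrite /= mul0mx -mulmxA mulmx_base mulmx_coker.
have C_exact m (z : 'M_(m, w + w)) : z *m C = 0 -> (z <= A)%MS.
  by move=> zC; rewrite submxE -(mulmx_base (cokermx A)) mulmxA zC mul0mx.
exists (\rank (cokermx A)), (- dsubmx C), (usubmx C); split.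
- by rewrite mxrank_coker (eqP PRfree) subnKC // -(eqP PRfree) rank_leq_col.
- move: AC; rewrite -{1}(vsubmxK C) mul_row_col => /eqP.
  by rewrite addr_eq0 mulmxN => /eqP.
move=> a b aa bb aP aR.
have aC : block_mx a 0 0 a *m C = C *m b.
  rewrite -{1}(vsubmxK C) mul_block_col !mul0mx addr0 add0r aR.
  rewrite -[C in RHS](vsubmxK C) mul_col_mx; congr col_mx.
  by apply/eqP; rewrite -eqr_opp -mulmxN aP mulNmx.
have /submxP[d dA] : (A *m block_mx a 0 0 a <= A)%MS.
  by apply: C_exact; rewrite -mulmxA aC mulmxA AC mul0mx.
have dPR : d *m P = P *m a /\ d *m R = R *m a.
  move: dA; rewrite /A mul_row_block !mulmx0 addr0 add0r mul_mx_row.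
  by case/eq_row_mx=> -> ->.
have dd : d *m d = d.
  apply: (row_free_inj PRfree); rewrite /= -mulmxA -dA mulmxA -dA -mulmxA.
  by rewrite mulmx_block !mulmx0 !mul0mx !addr0 !add0r aa.
have Cfull : row_full C := col_base_full _.
have [[_ a0]|[_ a1]] := PR_indec d a dd aa dPR.1 dPR.2; [left | right]; split=> //.
  apply: (row_full_inj Cfull); rewrite -aC a0 mulmx0.
  by rewrite (_ : block_mx _ _ _ _ = 0) ?mul0mx // -[RHS]block_mx0.
apply: (row_full_inj Cfull); rewrite -aC a1 mulmx1.
by rewrite -scalar_mx_block mul1mx.
Qed.

(** The p i are the coefficients of a polynomial vector in the kernel of
    the pencil P - x R.  Its images p i R = p (i + 1) P are the coefficients of
    such a vector for the reflected pencil, and of lower degree; induction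
    reduces to a common kernel vector of P and R.  Padding with p 0 = 0
    expresses the equation at the lower end like the others. *)
Lemma pencil_no_chain m v w (P R : 'M[k]_(v, w)) (p : nat -> 'rV[k]_v) :
  pencil_indec P R -> ~~ odd (v + w) ->
  p 0%N = 0 -> (forall i, (m <= i)%N -> p i = 0) ->
  (forall i, p i.+1 *m P = p i *m R) -> forall i, p i = 0.
Proof.
elim: m v w P R p => [|m IHm] v w P R p PR_indec even p0 pm pPR i; first exact: pm.
have PRfree := pencil_common_kernel PR_indec even.
have [c [P' [R' [dims PR' PR'_indec]]]] := pencil_reflection PR_indec PRfree.
have even' : ~~ odd (w + c).
  have : ~~ odd (v + w) == ~~ odd (w + c).
    have := congr1 odd dims; rewrite !oddD addbb => /esym/eqP.
    by case: (odd v) (odd w) (odd c) => [] [] [].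
  by move/eqP <-.
have q0 j : p j *m R = 0.
  apply: (IHm _ _ _ _ (fun j => p j *m R) PR'_indec even') => [|l le_ml|l].
  - by rewrite p0 mul0mx.
  - by rewrite -pPR pm ?mul0mx.
  - by rewrite /= -[LHS]mulmxA -PR' mulmxA pPR.
case: i => // i; apply: (row_free_inj PRfree).
by rewrite /= mul_mx_row pPR !q0 row_mx0 mul0mx.
Qed.

(** If v > w, then reflection gives dimensions (w, c) with w > c and a smaller
    sum, of the same parity: infinite descent. *)
Lemma pencil_le v w (P R : 'M[k]_(v, w)) :
  pencil_indec P R -> ~~ odd (v + w) -> (v <= w)%N.
Proof.
have [n] := ubnP (v + w); elim: n v w P R => // n IHn v w P R ltn PR_indec even.
have PRfree := pencil_common_kernel PR_indec even.
have [c [P' [R' [dims _ PR'_indec]]]] := pencil_reflection PR_indec PRfree.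
rewrite leqNgt; apply/negP => lt_wv.
have lt_cw : (c < w)%N by rewrite -(ltn_add2l v) -dims ltn_add2r.
have: (w <= c)%N.
  apply: (IHn _ _ P' R') => //.
    by apply: leq_trans (leq_add lt_wv (ltnW lt_cw)) _; rewrite -ltnS.
  move: even; have := congr1 odd dims; rewrite !oddD addbb.
  by case: (odd v) (odd w) (odd c) => [] [] [].
by rewrite leqNgt lt_cw.
Qed.

Lemma pencil_indec_tr v w (P R : 'M[k]_(v, w)) :
  pencil_indec P R -> pencil_indec P^T R^T.
Proof.
move=> PR_indec a b aa bb aP aR.
have [||||[b0 a0]|[b1 a1]] := PR_indec b^T a^T; rewrite -?trmx_mul ?aa ?bb //.
- by apply: trmx_inj; rewrite !trmx_mul !trmxK.
- by apply: trmx_inj; rewrite !trmx_mul !trmxK.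
- by left; rewrite -[a]trmxK -[b]trmxK a0 b0 !trmx0.
- by right; rewrite -[a]trmxK -[b]trmxK a1 b1 !trmx1.
Qed.

Lemma pencil_square v w (P R : 'M[k]_(v, w)) :
  pencil_indec P R -> ~~ odd (v + w) -> v = w.
Proof.
move=> PR_indec even; apply/eqP; rewrite eqn_leq (pencil_le PR_indec even).
by rewrite (pencil_le (pencil_indec_tr PR_indec)) // addnC.
Qed.

(** The iteration s -> d s N + c becomes stationary, since consecutive terms
    differ by d^i c N^i. *)
Lemma sylvester_nilpotent r r' m (d : 'M[k]_r') (c : 'M[k]_(r', r)) (N : 'M[k]_r) :
  N ^+ m = 0 -> exists s, s = d *m s *m N + c.
Proof.
move=> Nm; pose s i := iter i (fun s => d *m s *m N + c) 0.
have sS i : s i.+1 - s i = iter i (mulmx d) (s 1%N - s 0%N) *m N ^+ i.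
  elim: i => [|i IHi]; first by rewrite expr0 mulmx1.
  rewrite [s i.+2]iterS [X in _ - X]iterS opprD addrACA subrr addr0.
  by rewrite -mulmxBl -mulmxBr IHi iterS exprSr !mulmxA.
exists (s m); apply/eqP; rewrite -[X in _ == X]/(s m.+1) eq_sym -subr_eq0 sS.
by rewrite Nm mulmx0.
Qed.

Lemma unipotent_unit r r' (s : 'M[k]_(r', r)) : block_mx 1%:M 0 s 1%:M \in unitmx.
Proof. by rewrite unitmxE det_lblock !det1 mulr1 unitr1. Qed.

(** U spans a part on which R is bijective and P is nilpotent relative to R,
    while saturation makes P injective on the quotient by U.  The extension
    between the two parts splits: changing the complement U' to U' + s U
    removes the off-diagonal term of R once s solves a Sylvester equation whose
    one coefficient is N, hence nilpotent. *)
Lemma pencil_split n r r' m (P R : 'M[k]_n) (U : 'M[k]_(r, n)) (U' : 'M[k]_(r', n))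
    (N : 'M[k]_r) :
  (r + r' = n)%N -> pencil_indec P R -> row_free (col_mx U U') ->
  U *m P = N *m (U *m R) -> N ^+ m = 0 -> row_free (U *m R) ->
  (forall z : 'rV_n, (z *m P <= U *m R)%MS -> (z <= U)%MS) ->
  r = 0%N \/ r' = 0%N.
Proof.
move=> dims; case: _ / dims P R U U' => P R U U' PR_indec UU' UP Nm URfree Usat.
pose D := U' *m P.
have URD_free : row_free (col_mx (U *m R) D).
  apply: inj_row_free => z; rewrite -[z]hsubmxK mul_row_col => zURD.
  have z2U : (rsubmx z *m U' <= U)%MS.
    apply: Usat; rewrite -mulmxA -/D.
    have -> : rsubmx z *m D = - lsubmx z *m (U *m R).
      by apply/eqP; rewrite mulNmx -addr_eq0 addrC zURD.
    exact: submxMl.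
  have z2 : rsubmx z = 0.
    have /submxP[y yE] := z2U.
    have : row_mx (- y) (rsubmx z) *m col_mx U U' = 0.
      by rewrite mul_row_col yE mulNmx addNr.
    rewrite -[0 in RHS](mul0mx _ (col_mx U U')) => /(row_free_inj UU').
    by rewrite -row_mx0 => /eq_row_mx[].
  move: zURD; rewrite z2 mul0mx addr0 -[0 in RHS](mul0mx _ (U *m R)).
  by move/(row_free_inj URfree) => ->; rewrite row_mx0.
have URD_full : row_full (col_mx (U *m R) D) by rewrite row_full_unit -row_free_unit.
have /submxP[gd U'R] := submx_full (U' *m R) URD_full.
rewrite -[gd]hsubmxK mul_row_col in U'R.
have [s sE] := sylvester_nilpotent (rsubmx gd) (- lsubmx gd) Nm.
(* The complement in the target is the image of U' + s U under P, so that P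
   becomes block diagonal whatever s is. *)
pose B := col_mx U (U' + s *m U); pose C := col_mx (U *m R) ((U' + s *m U) *m P).
have B_unit : B \in unitmx.
  have -> : B = block_mx 1%:M 0 s 1%:M *m col_mx U U'.
    by rewrite mul_block_col !mul1mx mul0mx addr0 addrC.
  by rewrite unitmx_mul unipotent_unit -row_free_unit.
have C_unit : C \in unitmx.
  have -> : C = block_mx 1%:M 0 (s *m N) 1%:M *m col_mx (U *m R) D.
    rewrite mul_block_col !mul1mx mul0mx addr0 /C mulmxDl -[s *m U *m P]mulmxA UP.
    by rewrite !mulmxA addrC.
  by rewrite unitmx_mul unipotent_unit -row_free_unit.
have BP : B *m P = block_mx N 0 0 1%:M *m C.
  by rewrite mul_block_col !mul0mx mul1mx add0r addr0 mul_col_mx UP.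
have BR : B *m R = block_mx 1%:M 0 0 (rsubmx gd) *m C.
  rewrite mul_block_col !mul0mx mul1mx add0r addr0 mul_col_mx; congr col_mx.
  have sUR : s *m (U *m R) =
      rsubmx gd *m s *m N *m (U *m R) - lsubmx gd *m (U *m R).
    by rewrite {1}sE mulmxDl mulNmx.
  rewrite !mulmxDl U'R -/D -[s *m U *m R]mulmxA sUR -[s *m U *m P]mulmxA UP.
  by rewrite mulmxDr !mulmxA [in LHS]addrC addrA subrK addrC.
pose e : 'M[k]_(r + r') := block_mx 1%:M 0 0 0.
have eE x y : e *m block_mx x 0 0 y = block_mx x 0 0 y *m e.
  by rewrite !mulmx_block !(mulmx0, mul0mx, addr0, add0r) mul1mx mulmx1.
have ee : e *m e = e.
  by rewrite mulmx_block !(mulmx0, mul0mx, addr0, add0r) mul1mx.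
have intertwine X x y : B *m X = block_mx x 0 0 y *m C ->
  invmx B *m e *m B *m X = X *m (invmx C *m e *m C).
  move=> BX; rewrite -[LHS]mulmxA BX mulmxA -(mulmxA _ e) eE.
  rewrite -[in RHS](mulKmx B_unit X) BX !mulmxA mulmxK //.
have idem Z : Z \in unitmx -> invmx Z *m e *m Z *m (invmx Z *m e *m Z) = invmx Z *m e *m Z.
  by move=> ZU; rewrite !mulmxA mulmxK // -(mulmxA _ e e) ee.
have [[a0 _]|[a1 _]] := PR_indec _ _ (idem B B_unit) (idem C C_unit)
                          (intertwine _ _ _ BP) (intertwine _ _ _ BR).
  left; apply: scalar_mx_eq0; have : e = 0.
    by rewrite -[e](mulmxK B_unit) -[e *m B](mulKVmx B_unit) (mulmxA (invmx B)) a0 mulmx0 mul0mx.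
  by rewrite /e -(@block_mx0 _ r r' r r') => /eq_block_mx[].
right; apply: scalar_mx_eq0; have : e = 1%:M.
  by rewrite -[e](mulmxK B_unit) -[e *m B](mulKVmx B_unit) (mulmxA (invmx B)) a1 mulmx1 mulmxV.
by rewrite /e scalar_mx_block => /eq_block_mx[].
Qed.

Lemma submx_preimage m1 m2 n p (z : 'M[k]_(m1, n)) (P : 'M[k]_(n, p)) (Z : 'M[k]_(m2, p)) :
  (z <= kermx (P *m cokermx Z))%MS = (z *m P <= Z)%MS.
Proof. by rewrite [RHS]submxE -mulmxA; apply/sub_kermxP/eqP. Qed.

(** Fitting's lemma for the linear relation R^-1 P: the spaces V i consist of
    the vectors that the relation can send to 0 in i steps.  They stabilize,
    and R is injective on them because a kernel vector of R would close a
    chain, which [pencil_no_chain] forbids.  By [pencil_split] the limit is 0,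
    and P is injective, or everything, and R is injective.  Working with the
    relation instead of an invertible combination of P and R makes the argument
    valid over finite fields. *)
Lemma pencil_fitting n (P R : 'M[k]_n) : pencil_indec P R ->
  P \in unitmx \/ R \in unitmx.
Proof.
move=> PR_indec; have even : ~~ odd (n + n) by rewrite addnn odd_double.
pose V i := iter i (fun W => kermx (P *m cokermx (W *m R))) (0 : 'M[k]_n).
have VS m i (z : 'M_(m, n)) : (z <= V i.+1)%MS = (z *m P <= V i *m R)%MS.
  exact: submx_preimage.
have V_mono i : (V i <= V i.+1)%MS.
  elim: i => [|i IHi]; first exact: sub0mx.
  by rewrite VS; apply: submx_trans (submxMr R IHi); rewrite -VS.
have V_chain i (u : 'rV_n) : (u <= V i)%MS -> exists p : nat -> 'rV_n,
    [/\ p 0%N = 0, p i = u & forall j, (j < i)%N -> p j.+1 *m P = p j *m R].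
  elim: i u => [|i IHi] u.
    by rewrite submx0 => /eqP ->; exists (fun=> 0).
  rewrite VS => /submxP[y uP]; have [|p [p0 pi pPR]] := IHi (y *m V i).
    exact: submxMl.
  exists (fun j => if (j <= i)%N then p j else u); split; rewrite ?ltnn //.
  move=> j; rewrite ltnS => le_ji; rewrite le_ji.
  case: (ltngtP j i) le_ji => // [lt_ji|->] _; first exact: pPR.
  by rewrite pi uP mulmxA.
have V_inj i (u : 'rV_n) : (u <= V i)%MS -> u *m R = 0 -> u = 0.
  move=> /V_chain[p [p0 pi pPR]] uR.
  pose q j := if (j <= i)%N then p j else 0.
  have q0 := @pencil_no_chain i.+1 _ _ P R q PR_indec even p0.
  rewrite -pi; have <- : q i = p i by rewrite /q leqnn.
  apply: q0 => [j|j]; first by rewrite /q ltnNge => /negPf->.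
  rewrite /q; case: (ltngtP j i) => [lt_ji|lt_ij|->]; first exact: pPR.
    by rewrite !mul0mx.
  by rewrite mul0mx pi uR.
have V_le i j : (V i <= V (i + j)%N)%MS.
  elim: j => [|j IHj]; first by rewrite addn0.
  by rewrite addnS; apply: submx_trans IHj (V_mono _).
have V_injM i m (z : 'M_(m, n)) : (z <= V i)%MS -> z *m R = 0 -> z = 0.
  move=> zV zR; apply/row_matrixP => l; rewrite row0; apply: (V_inj i).
    exact: submx_trans (row_sub l z) zV.
  by rewrite -row_mul zR row0.
have [i Vi] : exists i, (V i.+1 <= V i)%MS.
  suff [//|] : (exists i, (V i.+1 <= V i)%MS) \/ (n.+1 <= \rank (V n.+1))%N.
    by rewrite ltnNge rank_leq_row.
  elim: n.+1 => [|j [?|le_j]]; [by right | by left |].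
  have [?|nV] := boolP (V j.+1 <= V j)%MS; first by left; exists j.
  right; apply: leq_ltn_trans le_j _; apply: rank_ltmx.
  by rewrite /ltmx V_mono.
pose U := row_base (V i); pose U' := row_base (V i)^C%MS.
have UV : (U :=: V i)%MS := eq_row_base _.
have URfree : row_free (U *m R).
  apply: inj_row_free => z; rewrite mulmxA => zUR.
  have : z *m U = 0 by apply: V_inj zUR; apply: submx_trans (submxMl _ _) _; rewrite UV.
  by move/eqP; rewrite mulmx_free_eq0 ?row_base_free // => /eqP.
have /submxP[N UP] : (U *m P <= U *m R)%MS.
  have UVS : (U <= V i.+1)%MS by rewrite UV.
  by rewrite VS in UVS; apply: submx_trans UVS _; rewrite submxMr // UV.
have Usat (z : 'rV_n) : (z *m P <= U *m R)%MS -> (z <= U)%MS.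
  move=> zP; rewrite UV; apply: submx_trans Vi; rewrite VS.
  by apply: submx_trans zP _; rewrite submxMr // UV.
have N_nilp j m (y : 'M_(m, \rank (V i))) : (y *m U <= V j)%MS -> y *m N ^+ j = 0.
  elim: j y => [|j IHj] y.
    rewrite submx0 mulmx_free_eq0 ?row_base_free // => /eqP ->.
    exact: mul0mx.
  rewrite VS -mulmxA UP => /submxP[x xE]; rewrite exprS mulmxA; apply: IHj.
  suff -> : y *m N *m U = x *m V j by apply: submxMl.
  apply/eqP; rewrite -subr_eq0; apply/eqP/(V_injM (i + j)%N); last first.
    by rewrite mulmxBl -[y *m N *m U *m R]mulmxA -[y *m N *m _]mulmxA xE mulmxA subrr.
  rewrite addmx_sub // ?eqmx_opp.
    by apply: submx_trans (V_le i j); rewrite -UV submxMl.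
  by rewrite addnC; apply: submx_trans (V_le j i); apply: submxMl.
have N0 : N ^+ i = 0.
  by rewrite -[LHS]mul1mx; apply: N_nilp; rewrite mul1mx UV.
have dims : (\rank (V i) + \rank (V i)^C = n)%N.
  by rewrite mxrank_compl subnKC // rank_leq_row.
have UU' : row_free (col_mx U U').
  rewrite /row_free -addsmxE (adds_eqmx UV (eq_row_base _)) dims.
  exact: addsmx_compl_full.
have [r0|r'0] := pencil_split dims PR_indec UU' UP N0 URfree Usat; [left|right].
  rewrite -row_free_unit; apply: inj_row_free => z zP.
  have : (z <= U)%MS by apply: Usat; rewrite zP sub0mx.
  by move/eqP: r0; rewrite UV mxrank_eq0 => /eqP ->; rewrite submx0 => /eqP.
rewrite -row_free_unit; apply: inj_row_free => z; apply: (V_inj i).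
by apply: submx_full; rewrite /row_full -[X in _ == X]dims r'0 addn0.
Qed.

Definition invertible v w (P : 'M[k]_(v, w)) := exists P', P *m P' = 1%:M /\ P' *m P = 1%:M.

Lemma pencil_even v w (P R : 'M[k]_(v, w)) :
  pencil_indec P R -> ~~ odd (v + w) -> invertible P \/ invertible R.
Proof.
move=> PR_indec even; have v_eq := pencil_square PR_indec even.
case: _ / v_eq P R PR_indec {even} => P R /pencil_fitting[PU|RU]; [left | right].
  by exists (invmx P); rewrite mulmxV ?mulVmx.
by exists (invmx R); rewrite mulmxV ?mulVmx.
Qed.

(** Here X and Y are endomorphisms of k^n that vanish on the span of D and map
    that of C into it; in the basis (C, D) they are given by P and R. *)
Section TwoStep.
Variables (v w n : nat) (C : 'M[k]_(v, n)) (D : 'M[k]_(w, n)).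
Hypotheses (dims : (v + w = n)%N) (CD : row_free (col_mx C D)).

Lemma pencil_of_indec (X Y : 'M[k]_n) (P R : 'M[k]_(v, w)) :
  C *m X = P *m D -> D *m X = 0 -> C *m Y = R *m D -> D *m Y = 0 ->
  (forall e : 'M_n, e *m X = X *m e -> e *m Y = Y *m e -> e *m e = e ->
     e = 0 \/ e = 1%:M) ->
  pencil_indec P R.
Proof.
case: _ / dims X Y C D CD => X Y C' D' CD' CX DX CY DY indec a b aa bb aP aR.
pose B := col_mx C' D'; have BU : B \in unitmx by rewrite -row_free_unit.
pose d := block_mx a 0 0 b; pose e := invmx B *m d *m B.
have dd : d *m d = d by rewrite mulmx_block !(mulmx0, mul0mx, addr0, add0r) aa bb.
have comm Z N : C' *m Z = N *m D' -> D' *m Z = 0 -> a *m N = N *m b ->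
    e *m Z = Z *m e.
  move=> CZ DZ aN; pose L : 'M_(v + w) := block_mx 0 N 0 0.
  have BZ : B *m Z = L *m B.
    by rewrite mul_block_col mul_col_mx CZ DZ !mul0mx !add0r.
  have dL : d *m L = L *m d.
    by rewrite !mulmx_block !(mulmx0, mul0mx, addr0, add0r) aN.
  rewrite -[LHS]mulmxA BZ mulmxA -(mulmxA _ d) dL -[in RHS](mulKmx BU Z) BZ.
  by rewrite !mulmxA mulmxK.
have [||||] := indec e.
- exact: comm CX DX aP.
- exact: comm CY DY aR.
- by rewrite /e !mulmxA mulmxK // -(mulmxA _ d d) dd.
- move=> e0; left; have : d = 0.
    by rewrite -[d](mulmxK BU) -[d *m B](mulKVmx BU) (mulmxA (invmx B)) -/e e0 mulmx0 mul0mx.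
  by rewrite /d -(@block_mx0 _ v w v w) => /eq_block_mx[-> _ _ ->].
move=> e1; right; have : d = 1%:M.
  by rewrite -[d](mulmxK BU) -[d *m B](mulKVmx BU) (mulmxA (invmx B)) -/e e1 mulmx1 mulmxV.
by rewrite /d scalar_mx_block => /eq_block_mx[-> _ _ ->].
Qed.

Lemma pencil_contraction (X : 'M[k]_n) (P : 'M[k]_(v, w)) :
  C *m X = P *m D -> D *m X = 0 -> invertible P ->
  exists ph, X *m ph + ph *m X = 1%:M.
Proof.
case: _ / dims X C D CD => X C' D' CD' CX DX [P' [PP' P'P]].
pose B := col_mx C' D'; have BU : B \in unitmx by rewrite -row_free_unit.
pose L : 'M_(v + w) := block_mx 0 P 0 0.
have BX : B *m X = L *m B.
  by rewrite mul_block_col mul_col_mx CX DX !mul0mx !add0r.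
pose L' : 'M_(v + w) := block_mx 0 0 P' 0.
have LL' : L *m L' + L' *m L = 1%:M.
  rewrite !mulmx_block !(mulmx0, mul0mx, addr0, add0r) PP' P'P.
  by rewrite add_block_mx !addr0 !add0r -scalar_mx_block.
exists (invmx B *m L' *m B).
have -> : X = invmx B *m L *m B by rewrite -mulmxA -BX mulKmx.
rewrite !mulmxA !mulmxK // -mulmxDl -!mulmxA -mulmxDr.
by rewrite LL' mulmx1 mulVmx.
Qed.

End TwoStep.
End Pencils.

(** * Modules over the four-group in characteristic 2 *)
Section FourGroupModules.

Variable k : fieldType.
Hypothesis char2 : 2 \in [pchar k].

Lemma add2r (V : lmodType k) (x : V) : x + x = 0.
Proof. by rewrite -mulr2n -scaler_nat (pcharf0 char2) scale0r. Qed.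

Lemma add2K (V : lmodType k) (x y : V) : x + (x + y) = y.
Proof. by rewrite addrA add2r add0r. Qed.

Lemma addr2_eq0 (V : lmodType k) (x y : V) : x + y = 0 -> x = y.
Proof. by move=> xy0; rewrite -[y](add2K x) xy0 addr0. Qed.

(** A module over <s, t> is given by two commuting involutions; s is
    [gen M true] and t is [gen M false].  The index makes statements symmetric
    in s and t. *)
Record v4mod := V4Mod {
  dim : nat;
  gen : bool -> 'M[k]_dim;
  genK : forall b, gen b *m gen b = 1%:M;
  genC : forall b c, gen b *m gen c = gen c *m gen b }.

Implicit Types (M N J A K Q : v4mod) (b c : bool).

(** The conjugation action on linear maps; the generators are their own
    inverses. *)
Definition act M N b (z : 'M[k]_(dim M, dim N)) := gen M b *m z *m gen N b.

Lemma actK M N b : involutive (@act M N b).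
Proof.
by move=> z; rewrite /act !mulmxA genK mul1mx -mulmxA genK mulmx1.
Qed.

Lemma actC M N b c (z : 'M[k]_(dim M, dim N)) : act b (act c z) = act c (act b z).
Proof. by rewrite /act !mulmxA [gen M b *m _]genC -!mulmxA [gen N c *m _]genC. Qed.

Lemma actD M N b (z w : 'M[k]_(dim M, dim N)) : act b (z + w) = act b z + act b w.
Proof. by rewrite /act mulmxDr mulmxDl. Qed.

Lemma actM M N K b (z : 'M[k]_(dim M, dim N)) (w : 'M[k]_(dim N, dim K)) :
  act b (z *m w) = act b z *m act b w.
Proof.
by rewrite /act !mulmxA -[_ *m gen N b *m gen N b]mulmxA genK mulmx1.
Qed.

Lemma act1 M b : act b (1%:M : 'M_(dim M)) = 1%:M.
Proof. by rewrite /act mulmx1 genK. Qed.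

Lemma act0 M N b : act b (0 : 'M_(dim M, dim N)) = 0.
Proof. by rewrite /act mulmx0 mul0mx. Qed.

Definition equivariant M N (z : 'M[k]_(dim M, dim N)) := forall b, act b z = z.

(** [tr b] is the trace from the trivial subgroup to <gen b>, but also from
    <gen (~~ b)>, or from <s t>, to the whole group. *)
Definition tr M N b (z : 'M[k]_(dim M, dim N)) := z + act b z.
Definition trG M N (z : 'M[k]_(dim M, dim N)) := tr true (tr false z).

Lemma trD M N b (z w : 'M[k]_(dim M, dim N)) : tr b (z + w) = tr b z + tr b w.
Proof. by rewrite /tr actD addrACA. Qed.

Lemma trC M N b c (z : 'M[k]_(dim M, dim N)) : tr b (tr c z) = tr c (tr b z).
Proof. by rewrite /tr !actD actC -!addrA; congr (_ + _); rewrite addrCA. Qed.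

Lemma trGE M N b (z : 'M[k]_(dim M, dim N)) : trG z = tr b (tr (~~ b) z).
Proof. by case: b => //; rewrite /trG trC. Qed.

Lemma act_tr M N b (z : 'M[k]_(dim M, dim N)) : act b (tr b z) = tr b z.
Proof. by rewrite /tr actD actK addrC. Qed.

Lemma tr_fix M N b (z : 'M[k]_(dim M, dim N)) : act b z = z -> tr b z = 0.
Proof. by rewrite /tr => ->; apply: add2r. Qed.

Lemma fix_tr M N b (z : 'M[k]_(dim M, dim N)) : tr b z = 0 -> act b z = z.
Proof. by move/addr2_eq0/esym. Qed.

Lemma tr_tr M N b (z : 'M[k]_(dim M, dim N)) : tr b (tr b z) = 0.
Proof. exact/tr_fix/act_tr. Qed.

Lemma trMl M N K b (z : 'M[k]_(dim M, dim N)) (w : 'M[k]_(dim N, dim K)) :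
  act b z = z -> tr b (z *m w) = z *m tr b w.
Proof. by move=> zb; rewrite /tr actM zb mulmxDr. Qed.

Lemma trMr M N K b (z : 'M[k]_(dim M, dim N)) (w : 'M[k]_(dim N, dim K)) :
  act b w = w -> tr b (z *m w) = tr b z *m w.
Proof. by move=> wb; rewrite /tr actM wb mulmxDl. Qed.

Lemma trGD M N (z w : 'M[k]_(dim M, dim N)) : trG (z + w) = trG z + trG w.
Proof. by rewrite /trG !trD. Qed.

Lemma trGMl M N K (z : 'M[k]_(dim M, dim N)) (w : 'M[k]_(dim N, dim K)) :
  equivariant z -> trG (z *m w) = z *m trG w.
Proof. by move=> zE; rewrite /trG !trMl. Qed.

Lemma trGMr M N K (z : 'M[k]_(dim M, dim N)) (w : 'M[k]_(dim N, dim K)) :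
  equivariant w -> trG (z *m w) = trG z *m w.
Proof. by move=> wE; rewrite /trG !trMr. Qed.

Lemma trG_equiv M N (z : 'M[k]_(dim M, dim N)) : equivariant (trG z).
Proof. by move=> b; rewrite (trGE b) act_tr. Qed.

Lemma equivD M N (z w : 'M[k]_(dim M, dim N)) :
  equivariant z -> equivariant w -> equivariant (z + w).
Proof. by move=> zE wE b; rewrite actD zE wE. Qed.

Lemma equivM M N K (z : 'M[k]_(dim M, dim N)) (w : 'M[k]_(dim N, dim K)) :
  equivariant z -> equivariant w -> equivariant (z *m w).
Proof. by move=> zE wE b; rewrite actM zE wE. Qed.

Lemma equiv1 M : equivariant (1%:M : 'M_(dim M)).
Proof. by move=> b; apply: act1. Qed.

Lemma equiv_comm M N (z : 'M[k]_(dim M, dim N)) :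
  equivariant z <-> forall b, gen M b *m z = z *m gen N b.
Proof.
split=> zE b; last by rewrite /act zE -mulmxA genK mulmx1.
by rewrite -{2}(zE b) /act -mulmxA genK mulmx1.
Qed.

Lemma equiv_inv M (z : 'M[k]_(dim M)) :
  equivariant z -> equivariant (invmx z).
Proof.
move=> zE; have [zU|/invmx_out->//] := boolP (z \in unitmx).
move=> b; rewrite -[LHS]mul1mx -(mulVmx zU) -mulmxA -{2}(zE b) -actM.
by rewrite mulmxV // act1 mulmx1.
Qed.

(** Higman's criterion for projectivity, equivalently injectivity. *)
Definition projective J := exists th : 'M[k]_(dim J), trG th = 1%:M.

(** Exactness over a field is recorded by linear maps r and s that split the
    sequence; they are not required to be equivariant. *)
Definition short_exact M J N
    (i : 'M[k]_(dim M, dim J)) (p : 'M[k]_(dim J, dim N)) :=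
  [/\ equivariant i, equivariant p & exists r s,
   [/\ i *m r = 1%:M, s *m p = 1%:M, i *m p = 0 & r *m i + p *m s = 1%:M]].

Section Exact.
Variables (M J N : v4mod) (i : 'M[k]_(dim M, dim J)) (p : 'M[k]_(dim J, dim N)).
Hypothesis ipE : short_exact i p.

Lemma ses_factor m (z : 'M[k]_(dim J, m)) : i *m z = 0 -> exists w, z = p *m w.
Proof.
have [_ _ [r [s [_ _ _ rips]]]] := ipE => iz.
by exists (s *m z); rewrite mulmxA -[LHS]mul1mx -rips mulmxDl -mulmxA iz mulmx0 add0r.
Qed.

Lemma ses_lift m (z : 'M[k]_(m, dim J)) : z *m p = 0 -> exists w, z = w *m i.
Proof.
have [_ _ [r [s [_ _ _ rips]]]] := ipE => zp.
by exists (z *m r); rewrite -mulmxA -[LHS]mulmx1 -rips mulmxDr [z *m (p *m s)]mulmxA zp mul0mx addr0.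
Qed.

Lemma ses_epi m (z w : 'M[k]_(dim N, m)) : p *m z = p *m w -> z = w.
Proof.
have [_ _ [r [s [_ sp _ _]]]] := ipE => pz.
by rewrite -[z]mul1mx -sp -mulmxA pz mulmxA sp mul1mx.
Qed.

Lemma ses_mono m (z w : 'M[k]_(m, dim M)) : z *m i = w *m i -> z = w.
Proof.
have [_ _ [r [s [ir _ _ _]]]] := ipE => zi.
by rewrite -[z]mulmx1 -ir mulmxA zi -mulmxA ir mulmx1.
Qed.

Lemma ses_epi_equiv K (w : 'M[k]_(dim N, dim K)) :
  equivariant (p *m w) -> equivariant w.
Proof.
have [_ pE _] := ipE => pwE b; apply: ses_epi.
by rewrite -{1}(pE b) -actM pwE.
Qed.

Lemma ses_mono_equiv K (w : 'M[k]_(dim K, dim M)) :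
  equivariant (w *m i) -> equivariant w.
Proof.
have [iE _ _] := ipE => wiE b; apply: ses_mono.
by rewrite -{1}(iE b) -actM wiE.
Qed.

(** Division by the class c in H^1 whose kernel is <gen b>: the map ph
    represents the product by c, from M to its cosyzygy N, and a map xi that is
    stably trivial on <gen b> is stably ph followed by xi'.  Moreover xi'
    remains stably trivial on <gen (~~ b)> if xi is.  Indeed, being a trace,
    xi extends to a map rho : J -> K that commutes with gen b, and the
    trace of rho to the whole group kills M; xi' is the map it induces on N. *)
Lemma divide b : projective J ->
  exists ph : 'M[k]_(dim M, dim N),
  [/\ equivariant ph, exists mu, ph = tr b mu &
  forall K (xi : 'M[k]_(dim M, dim K)) mu, equivariant xi -> xi = tr b mu ->
  exists xi' : 'M[k]_(dim N, dim K),
  [/\ equivariant xi', exists om, xi = ph *m xi' + trG om &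
      forall mu1, xi = tr (~~ b) mu1 -> exists nu, xi' = tr (~~ b) nu]].
Proof.
move=> [th th1]; have [iE pE [r [s [ir sp ip _]]]] := ipE.
have trip : tr (~~ b) (tr b (i *m th)) = i.
  by rewrite trC -trGE trGMl // th1 mulmx1.
exists (tr b (i *m th *m p)); split; last 1 first.
- move=> K xi mu xiE xi_mu.
  pose rho := tr b (r *m mu).
  have irho : i *m rho = xi by rewrite -trMl // mulmxA ir mul1mx.
  have [|xi' xi'E] := @ses_factor _ (tr (~~ b) rho).
    by rewrite -trMl // irho tr_fix.
  have pxiE : equivariant (p *m xi').
    move=> c; rewrite -xi'E trC; have [->|] := eqVneq c b; first by rewrite act_tr.
    by case: (c) (b) => [] [] // _; rewrite trC act_tr.
  exists xi'; split.
  + exact: ses_epi_equiv.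
  + exists (i *m th *m act (~~ b) rho).
    rewrite (trGE b) trC [X in _ + tr _ X]trMr; last by rewrite actC act_tr.
    rewrite trMr // -mulmxA -xi'E.
    rewrite -{1}irho -{1}trip; set B := tr b _.
    rewrite /tr actM actK mulmxDl [B *m (rho + _)]mulmxDr.
    by rewrite -[RHS]addrA add2K.
  + move=> mu1 xi_mu1.
    (* Subtracting from rho a trace over gen (~~ b) that also extends xi does not
       change its trace, and the difference kills M. *)
    have [|nu nuE] := @ses_factor _ (rho + tr (~~ b) (r *m mu1)).
      by rewrite mulmxDr irho -trMl // mulmxA ir mul1mx -xi_mu1 add2r.
    exists nu; apply: ses_epi; rewrite -xi'E -trMl // -nuE trD.
    by rewrite tr_tr addr0.
- move=> c; have [->|] := eqVneq c b; first by rewrite act_tr.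
  move=> ne_cb; have -> : c = ~~ b by case: (c) (b) ne_cb => [] [].
  by apply: fix_tr; rewrite trMr // trMr // trip ip.
- by exists (i *m th *m p).
Qed.

End Exact.

(** Fitting's lemma: e is the projection on the part where ph is invertible,
    along the part where ph is nilpotent.  It is a polynomial in ph, obtained
    from a Bezout relation between a power of X and the factor of the
    characteristic polynomial that is prime to X. *)
Lemma fitting_idempotent n (ph : 'M[k]_n) : exists e : 'M[k]_n,
  [/\ e *m e = e, forall a : 'M[k]_n, a *m ph = ph *m a -> a *m e = e *m a,
      forall m (z : 'M[k]_(n, m)), ph *m z = z -> e *m z = z
    & e = 1%:M -> ph \in unitmx].
Proof.
case: n ph => [|n] ph.
  exists 1%:M; split=> [|a _|m z _|_]; rewrite ?mul1mx ?mulmx1 //.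
  by rewrite flatmx0 -[X in X \in _](flatmx0 1%:M) unitmx1.
have [m [q nz_q def_p]] := multiplicity_XsubC (char_poly ph) 0.
rewrite (monic_neq0 (char_poly_monic ph)) /= in nz_q.
rewrite subr0 in def_p.
(* The exponent m + 1 instead of m puts a factor ph in e even when m = 0, so that
   e = 1 exhibits an inverse of ph. *)
have /Bezout_eq1_coprimepP[[v u] /= vq_uX] : coprimep q ('X ^+ m.+1).
  by rewrite coprimep_expr // coprimepX.
pose h := horner_mx ph.
have hX d : h ('X ^+ d) = ph ^+ d by rewrite /h rmorphXn /= horner_mx_X.
have hM (a b : {poly k}) : h (a * b) = h a * h b by rewrite /h rmorphM.
have e1 : 1 - h (u * 'X ^+ m.+1) = h (v * q).
  by rewrite -(rmorph1 h) -vq_uX rmorphD addrK.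
have Xe : ph ^+ m.+1 * (1 - h (u * 'X ^+ m.+1)) = 0.
  rewrite e1 -hX -hM exprS mulrACA ['X^m * q]mulrC -def_p.
  by rewrite hM [h (char_poly _)]Cayley_Hamilton mulr0.
exists (h (u * 'X ^+ m.+1)); split.
- have : h (u * 'X ^+ m.+1) * (1 - h (u * 'X ^+ m.+1)) = 0.
    by rewrite {1}hM hX -mulrA Xe mulr0.
  by rewrite mulrBr mulr1 => /eqP; rewrite subr_eq0 => /eqP/esym.
- by move=> a /(comm_mx_horner (u * 'X ^+ m.+1)).
- move=> m' z phz; apply/esym/eqP; rewrite -subr_eq0 -{1}[z]mul1mx -mulmxBl.
  have Xz d : ph ^+ d *m z = z.
    by elim: d => [|d IHd]; rewrite ?expr0 ?mul1mx // exprS -mulmxA IHd.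
  rewrite -[z in _ *m z](Xz m.+1) mulmxA.
  have eX : (1 - h (u * 'X ^+ m.+1)) * ph ^+ m.+1 = 0.
    by rewrite -[RHS]Xe e1 -hX -!hM mulrC.
  by rewrite (_ : _ *m ph ^+ m.+1 = 0) ?mul0mx //; apply: eX.
- move=> e1'.
  have : h (u * 'X ^+ m) *m ph = 1%:M.
    by rewrite -e1' exprSr mulrA (hM _ 'X) [h 'X]horner_mx_X.
  by case/mulmx1_unit.
Qed.

Definition right_minimal Q M (pi : 'M[k]_(dim Q, dim M)) :=
  forall e : 'M[k]_(dim Q), equivariant e -> e *m e = e -> e *m pi = pi ->
  e = 1%:M.

Lemma right_minimal_unit Q M (pi : 'M[k]_(dim Q, dim M)) (ph : 'M[k]_(dim Q)) :
  right_minimal pi -> equivariant ph -> ph *m pi = pi -> ph \in unitmx.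
Proof.
move=> pi_min phE phpi; have [e [ee eC epi e1]] := fitting_idempotent ph.
apply/e1/pi_min => //; last exact: epi.
by apply/equiv_comm => b; apply: eC; move: b; apply/equiv_comm.
Qed.

(** Conjugation by the product of the two generators. *)
Definition act3 M N (z : 'M[k]_(dim M, dim N)) := act true (act false z).

Lemma act3D M N (z w : 'M[k]_(dim M, dim N)) : act3 (z + w) = act3 z + act3 w.
Proof. by rewrite /act3 !actD. Qed.

Lemma act3M M N K (z : 'M[k]_(dim M, dim N)) (w : 'M[k]_(dim N, dim K)) :
  act3 (z *m w) = act3 z *m act3 w.
Proof. by rewrite /act3 !actM. Qed.

Lemma equiv_act3 M N (z : 'M[k]_(dim M, dim N)) : equivariant z -> act3 z = z.
Proof. by move=> zE; rewrite /act3 !zE. Qed.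

(** Higman's criterion for projectivity relative to the three subgroups of
    order 2: th true, th false and th3 commute with s, t and st respectively. *)
Definition chi_projective Q := exists th : bool -> 'M[k]_(dim Q), exists th3,
  [/\ forall b, act b (th b) = th b, act3 th3 = th3 &
      tr false (th true) + tr true (th false) + tr true th3 = 1%:M].

(** The argument of the introduction, with K the kernel of the cover and
    A the second cosyzygy.  The extension Q'' is the space M + A with the action
    twisted by the cocycle ph := ph0 ph1 times the class of <s t>; it appears
    only through maps.  A map Q -> Q'' over M is a map
    ga : Q -> A commuting with s t whose trace is pi ph, and a map Q'' -> Q
    over M that extends f is a section s3' of pi commuting with s t
    whose trace is ph f. *)
Lemma syzygy_retract M J0 N J1 A K Q
    (i0 : 'M[k]_(dim M, dim J0)) (p0 : 'M[k]_(dim J0, dim N))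
    (i1 : 'M[k]_(dim N, dim J1)) (p1 : 'M[k]_(dim J1, dim A))
    (io : 'M[k]_(dim K, dim Q)) (pi : 'M[k]_(dim Q, dim M))
    (s : bool -> 'M[k]_(dim M, dim Q)) (s3 : 'M[k]_(dim M, dim Q)) :
  short_exact i0 p0 -> projective J0 -> short_exact i1 p1 -> projective J1 ->
  short_exact io pi -> chi_projective Q -> right_minimal pi ->
  (forall b, act b (s b) = s b) -> (forall b, s b *m pi = 1%:M) ->
  act3 s3 = s3 -> s3 *m pi = 1%:M ->
  exists f : 'M[k]_(dim A, dim K), exists g : 'M[k]_(dim K, dim A),
  [/\ equivariant f, equivariant g & g *m f \in unitmx].
Proof.
move=> ex0 pJ0 ex1 pJ1 exQ [th [th3 [thb th3b th1]]] pi_min sb spi s3b s3pi.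
have [ioE piE [ka [sg [ioka sgpi iopi _]]]] := exQ.
have s3tf : act true s3 = act false s3 by rewrite -{1}s3b /act3 actK.
(* The class of Q is the class of <s t> times xi; differences of sections show
   that xi is stably trivial on <s> and on <t>. *)
have [|xi xiE] := @ses_lift _ _ _ _ _ exQ _ (tr true s3).
  by rewrite -trMr // s3pi tr_fix ?act1.
have xi_equiv : equivariant xi.
  apply: (ses_mono_equiv exQ) => b; rewrite -xiE.
  by case: b; rewrite ?act_tr // /tr s3tf -/(tr false s3) act_tr.
have xi_tr b : exists mu, xi = tr b mu.
  have [|mu muE] := @ses_lift _ _ _ _ _ exQ _ (s3 + s b).
    by rewrite mulmxDl s3pi spi add2r.
  exists mu; apply: (ses_mono exQ); rewrite -trMr // -muE -xiE trD.
  by rewrite [tr b (s b)]tr_fix // addr0 /tr; case: b {muE}; rewrite ?s3tf.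
have [mu0 xi_mu0] := xi_tr false; have [mu1 xi_mu1] := xi_tr true.
(* Divide xi by the class of <t>, then by that of <s>. *)
have [ph0 [ph0E [la0 ph0_la0] div0]] := divide ex0 false pJ0.
have [xi' [xi'E [om0 xi_om0] /(_ mu1)[//|nu xi'_nu]]] := div0 _ _ _ xi_equiv xi_mu0.
have [ph1 [ph1E [la1 ph1_la1] div1]] := divide ex1 true pJ1.
have [f [fE [om1 xi'_om1] _]] := div1 _ _ _ xi'E xi'_nu.
pose ph := ph0 *m ph1; have phE : equivariant ph by apply: equivM.
have xi_ph : xi = ph *m f + trG (ph0 *m om1 + om0).
  by rewrite trGD trGMl // addrA -mulmxA -mulmxDr -xi'_om1.
set om := (X in trG X) in xi_ph.
have ph_tr b : exists la, ph = tr b la.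
  case: b; first by exists (ph0 *m la1); rewrite trMl // -ph1_la1.
  by exists (la0 *m ph1); rewrite trMr // -ph0_la0.
have [lat ph_lat] := ph_tr true; have [laf ph_laf] := ph_tr false.
pose tr3 M N (z : 'M[k]_(dim M, dim N)) := z + act3 z.
have tr_tr3 X Y (z : 'M[k]_(dim X, dim Y)) : tr true (tr3 X Y z) = trG z.
  rewrite /tr3 /trG trD /act3 /tr !actD !actK -!addrA.
  by rewrite [_ + act false z]addrC [act true z + (_ + _)]addrCA.
have act3_tr3 X Y (z : 'M[k]_(dim X, dim Y)) : act3 (tr3 X Y z) = tr3 X Y z.
  by rewrite /tr3 /act3 !actD (actC false true) !actK addrC.
(* On Q, insert the identity as a sum of traces.  As ph is a trace over <s> and
   over <t>, each term is the trace of a map that commutes with s t. *)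
pose ga := th3 *m pi *m ph
   + tr3 _ _ (th true *m pi *m lat) + tr3 _ _ (th false *m pi *m laf).
have ga3 : act3 ga = ga.
  rewrite 2!act3D !act3_tr3.
  by rewrite 2!act3M (equiv_act3 piE) // (equiv_act3 phE) // th3b.
have ga_tr : tr true ga = pi *m ph.
  rewrite /ga 2!trD !tr_tr3 (trGE false (th true *m _ *m _)) (trGE true) /=.
  rewrite [tr true (th true *m _ *m _)]trMl; last by rewrite actM thb piE.
  rewrite [tr false (th false *m _ *m _)]trMl; last by rewrite actM thb piE.
  rewrite -ph_lat -ph_laf !(trMr _ (phE _)) !(trMr _ (piE _)) -!mulmxDl.
  by rewrite -addrA addrC th1 mul1mx.
pose g := io *m ga.
have g3 : act3 g = g by rewrite act3M (equiv_act3 ioE) // ga3.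
have gE : equivariant g.
  have g1 : act true g = g.
    by apply: fix_tr; rewrite trMl // ga_tr mulmxA iopi mul0mx.
  case=> //; rewrite -{1}g3 /act3 (actC true) actK //.
(* Correct the section s3 to make its trace exactly ph f. *)
pose s3' := s3 + tr3 _ _ om *m io.
have s3'_tr : tr true s3' = ph *m f *m io.
  rewrite trD xiE trMr // tr_tr3 xi_ph -mulmxDl -addrA -trGD addrC.
  by rewrite trGD add2r add0r.
have s3'3 : act3 s3' = s3'.
  by rewrite act3D act3M act3_tr3 (equiv_act3 ioE) // s3b.
pose Ph := pi *m s3' + ga *m f *m io.
have Ph1 : act true Ph = Ph.
  apply: fix_tr; rewrite trD trMl // s3'_tr trMr // trMr // ga_tr.
  by rewrite !mulmxA add2r.
have Ph3 : act3 Ph = Ph.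
  rewrite act3D 3!act3M s3'3 ga3.
  by rewrite (equiv_act3 piE) // (equiv_act3 fE) // (equiv_act3 ioE).
have PhE : equivariant Ph.
  by case=> //; rewrite -{1}Ph3 /act3 (actC true) actK.
have Phpi : Ph *m pi = pi.
  rewrite mulmxDl -!mulmxA iopi !mulmx0 addr0 mulmxDl s3pi -mulmxA iopi.
  by rewrite mulmx0 addr0 mulmx1.
have PhU := right_minimal_unit pi_min PhE Phpi.
exists f, g; split=> //.
have gf : g *m f *m io = io *m Ph.
  by rewrite mulmxDr !mulmxA iopi mul0mx add0r.
(* The inverse of Ph also preserves the kernel of pi; w is its restriction. *)
have [|w wE] := @ses_lift _ _ _ _ _ exQ _ (io *m invmx Ph).
  by rewrite -[in X in _ *m X]Phpi mulmxA mulmxKV.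
apply: (@mulmx1_unit _ _ w _ _).2; apply: (ses_mono exQ).
by rewrite -mulmxA gf mulmxA -wE mulmxKV // mul1mx.
Qed.

(** This holds for indecomposable modules, and for the zero module. *)
Definition idem_trivial M :=
  forall e : 'M[k]_(dim M), equivariant e -> e *m e = e -> e = 0 \/ e = 1%:M.

Definition aug M b : 'M[k]_(dim M) := gen M b + 1%:M.
(** The product is the sum of the four group elements, which is nonzero on every
    module with a free summand. *)
Definition norm_zero M := aug M true *m aug M false = 0.

Lemma aug_sq M b : aug M b *m aug M b = 0.
Proof. by rewrite /aug mulmxDl mulmxDr genK mulmx1 mul1mx [X in _ + X]addrC add2r. Qed.

Lemma augC M b c : aug M b *m aug M c = aug M c *m aug M b.
Proof.
rewrite /aug !mulmxDl !mulmxDr !mulmx1 !mul1mx genC -!addrA.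
by congr (_ + _); rewrite addrCA.
Qed.

Lemma trE M b (z : 'M[k]_(dim M)) :
  tr b z = aug M b *m z + z *m aug M b + aug M b *m z *m aug M b.
Proof.
have Xz : aug M b *m z = gen M b *m z + z by rewrite mulmxDl mul1mx.
rewrite -addrA [z *m _ + _]addrC -mulmxDl Xz -[_ + z + z]addrA add2r addr0.
rewrite /aug mulmxDr mulmx1 [gen M b *m z + z]addrC [_ + gen M b *m z]addrC.
by rewrite -addrA add2K.
Qed.

Lemma tr_aug M b (z : 'M[k]_(dim M)) :
  tr b z *m aug M b = aug M b *m z *m aug M b.
Proof.
by rewrite trE !mulmxDl -!mulmxA aug_sq !mulmx0 !addr0.
Qed.

(** The trace of z is X z Y + Y z X for the augmentations X and Y of the two
    generators, and the products of two of these vanish.  Hence the maps that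
    factor through a projective module are negligible. *)
Lemma projective_square M (z : 'M[k]_(dim M)) :
  norm_zero M -> trG z *m trG z = 0.
Proof.
move=> XY0; pose X := aug M true; pose Y := aug M false.
have XY : X *m Y = 0 by [].
have YX : Y *m X = 0 by rewrite augC.
have XX : X *m X = 0 by apply: aug_sq.
have YY : Y *m Y = 0 by apply: aug_sq.
have trX w : tr true w = X *m w + w *m X + X *m w *m X by apply: trE.
have trY w : tr false w = Y *m w + w *m Y + Y *m w *m Y by apply: trE.
clearbody X Y; have -> : trG z = X *m z *m Y + Y *m z *m X.
  rewrite /trG trX trY !mulmxDr !mulmxDl !mulmxA XY !mul0mx.
  by rewrite -!mulmxA !YX !mulmx0 !addr0 !add0r.
rewrite mulmxDl !mulmxDr !mulmxA -![_ *m _ *m X *m X]mulmxA -![_ *m _ *m X *m Y]mulmxA.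
rewrite -![_ *m _ *m Y *m X]mulmxA -![_ *m _ *m Y *m Y]mulmxA XX XY YX YY.
by rewrite !mulmx0 !mul0mx !addr0.
Qed.

Lemma projective_factor M J N (a : 'M[k]_(dim M, dim J)) (b : 'M[k]_(dim J, dim N)) :
  projective J -> equivariant a -> equivariant b -> exists z, a *m b = trG z.
Proof.
move=> [th th1] aE bE; exists (a *m th *m b).
by rewrite trGMr // trGMl // th1 mulmx1.
Qed.

(** In characteristic 2, if e^2 - e squares to zero then e^2 is idempotent. *)
Lemma idem_trivial_lift M (e : 'M[k]_(dim M)) :
  idem_trivial M -> equivariant e -> (e *m e + e) *m (e *m e + e) = 0 ->
  e *m e = 0 \/ (e + 1%:M) *m (e + 1%:M) = 0.
Proof.
move=> Mt eE e2; have ee_idem : e *m e *m (e *m e) = e *m e.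
  apply: addr2_eq0; rewrite -[RHS]e2 mulmxDl !mulmxDr -addrA.
  by rewrite -[e *m e *m e]mulmxA add2K.
have [|->|ee1] := Mt (e *m e) _ ee_idem; first exact: equivM; first by left.
right; rewrite mulmxDl mulmxDr mulmx1 mul1mx ee1 -addrA add2K.
exact: add2r.
Qed.

(** Endomorphisms of M and N agree up to maps that factor through J.  An
    idempotent e of N lifts to an endomorphism a of J, which restricts to d on
    M; there d is idempotent up to a map that squares to zero, so d or d + 1
    is nilpotent.  Accordingly e or e + 1 factors through J, and
    being idempotent it vanishes. *)
Lemma idem_trivial_cosyzygy M J N
    (i : 'M[k]_(dim M, dim J)) (p : 'M[k]_(dim J, dim N)) :
  short_exact i p -> projective J -> norm_zero M -> norm_zero N ->
  idem_trivial M -> idem_trivial N.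
Proof.
move=> ex pJ M0 N0 Mt e eE ee; have [th th1] := pJ.
have [iE pE [r [s [ir sp ip _]]]] := ex.
have kills (a : 'M[k]_(dim J)) (d : 'M[k]_(dim N)) :
    equivariant a -> a *m p = p *m d -> d *m d = d -> i *m (a *m a) = 0 -> d = 0.
  move=> aE apd dd /(ses_factor ex)[h aah].
  have hE : equivariant h by apply: (ses_epi_equiv ex); rewrite -aah; apply: equivM.
  have dhp : d = h *m p.
    by apply: (ses_epi ex); rewrite mulmxA -aah -mulmxA apd mulmxA apd -mulmxA dd.
  have [z dz] := projective_factor pJ hE pE.
  by rewrite -dd dhp dz projective_square.
pose a := trG (th *m (p *m e *m s)).
have aE : equivariant a by apply: trG_equiv.
have ap : a *m p = p *m e.
  rewrite -trGMr // -!mulmxA sp mulmx1 trGMr ?th1 ?mul1mx //; exact: equivM.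
have [|d ia] := @ses_lift _ _ _ _ _ ex _ (i *m a).
  by rewrite -mulmxA ap mulmxA ip mul0mx.
have dE : equivariant d by apply: (ses_mono_equiv ex); rewrite -ia; apply: equivM.
have [|h aah] := @ses_lift _ _ _ _ _ ex _ (a *m a + a).
  by rewrite mulmxDl -mulmxA ap mulmxA ap -mulmxA ee add2r.
have hE : equivariant h.
  apply: (ses_mono_equiv ex); rewrite -aah; apply: equivD => //; exact: equivM.
have dd : d *m d + d = i *m h.
  apply: (ses_mono ex); rewrite -mulmxA -aah mulmxDl mulmxDr -ia.
  by rewrite mulmxA ia -!mulmxA ia.
have [z dz] := projective_factor pJ iE hE.
have [|d0|d1] := idem_trivial_lift Mt dE; first by rewrite dd dz projective_square.
- by left; apply: (kills a) => //; rewrite mulmxA ia -mulmxA ia mulmxA d0 mul0mx.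
right; apply/esym/addr2_eq0; rewrite addrC; apply: (kills (a + 1%:M)).
- by apply: equivD => //; apply: equiv1.
- by rewrite mulmxDl mulmxDr mul1mx mulmx1 ap.
- rewrite mulmxDl mulmxDr mulmx1 mul1mx ee -addrA.
  by rewrite add2K.
- have ia1 : i *m (a + 1%:M) = (d + 1%:M) *m i.
    by rewrite mulmxDl mulmxDr mul1mx mulmx1 ia.
  by rewrite mulmxA ia1 -mulmxA ia1 mulmxA d1 mul0mx.
Qed.

(** If m X Y is nonzero, then m generates a free submodule, which splits off by
    injectivity.  Concretely, let la be a functional with value 1 on m X Y; the
    trace e of the rank one map la m fixes X Y la, so it is not nilpotent, and
    then it is invertible by Fitting's lemma, making the identity a trace. *)
Lemma nonprojective_norm_zero M : idem_trivial M -> ~ projective M -> norm_zero M.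
Proof.
move=> Mt npM; apply/eqP/negPn/negP => XY_neq0; apply: npM.
have /rowV0Pn[v /submxP[m vE] v_neq0] := XY_neq0.
have [la vla] := row_dual v_neq0.
set X := aug M true in XY_neq0 vE; set Y := aug M false in XY_neq0 vE.
have mla : m *m (X *m Y) *m la = 1%:M by rewrite -vE.
pose e := trG (la *m m).
have eE : equivariant e by apply: trG_equiv.
have eXY : e *m (X *m Y) = X *m Y *m (la *m m) *m (X *m Y).
  rewrite mulmxA /e /trG tr_aug -/X; set w := tr false _.
  have XYC : X *m Y = Y *m X by apply: augC.
  have wY : w *m Y = Y *m (la *m m) *m Y by apply: tr_aug.
  rewrite -[LHS]mulmxA [X *m Y in LHS]XYC -[LHS]mulmxA (mulmxA w) wY.
  by rewrite -[_ *m Y *m X]mulmxA -XYC !mulmxA.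
have [f [ff fC fz f1]] := fitting_idempotent e.
have fE : equivariant f.
  by apply/equiv_comm => b; apply: fC; move: b; apply/equiv_comm.
have fXY : f *m (X *m Y *m la) = X *m Y *m la.
  by apply: fz; rewrite mulmxA eXY -!mulmxA (mulmxA X Y la) (mulmxA m) mla mulmx1 mulmxA.
have [f0|/f1 eU] := Mt f fE ff.
  move: mla; rewrite -mulmxA -fXY f0 mul0mx mulmx0 => /matrixP/(_ 0 0)/eqP.
  by rewrite !mxE eq_sym oner_eq0.
exists (la *m m *m invmx e); rewrite trGMr ?mulmxV //.
exact: equiv_inv.
Qed.

Lemma projective_chi_projective M : projective M -> chi_projective M.
Proof.
move=> [z z1]; exists (fun b => if b then tr true z else 0), 0; split.
- by case; rewrite ?act_tr ?act0.
- by rewrite /act3 !act0.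
- by rewrite trC -/(trG z) z1 /tr !act0 !addr0.
Qed.

(** The module [ext_mod] is M tensored with the permutation module on the
    cosets of <gen b>, that is, the restriction of M to <gen b> induced back
    up.  It is an extension of M by M, and projective as soon as M is projective
    on <gen b>. *)
Section SelfExtension.
Variables (M : v4mod) (b : bool).

Let ext_gen c := block_mx (gen M c) (if c == b then 0 else gen M c) 0 (gen M c).

Lemma ext_genK c : ext_gen c *m ext_gen c = 1%:M.
Proof.
rewrite /ext_gen mulmx_block !mul0mx !mulmx0 !addr0 !add0r !genK.
by case: ifP => _; rewrite ?mulmx0 ?mul0mx ?genK add2r -scalar_mx_block.
Qed.

Lemma ext_genC c d : ext_gen c *m ext_gen d = ext_gen d *m ext_gen c.
Proof.
rewrite /ext_gen !mulmx_block !mul0mx !mulmx0 !addr0 !add0r (genC M c d).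
by case: (c == b); case: (d == b); rewrite ?mulmx0 ?mul0mx ?addr0 ?add0r ?(genC M c d).
Qed.

Definition ext_mod := V4Mod ext_genK ext_genC.

Let i : 'M[k]_(dim M, dim ext_mod) := row_mx 0 1%:M.
Let p : 'M[k]_(dim ext_mod, dim M) := col_mx 1%:M 0.

Lemma ext_exact : short_exact i p.
Proof.
split.
- apply/equiv_comm => c; rewrite /i /= /ext_gen mul_row_block mul_mx_row.
  by rewrite !mulmx0 !mul0mx mul1mx mulmx1 !add0r.
- apply/equiv_comm => c; rewrite /p /= /ext_gen mul_block_col mul_col_mx.
  by rewrite !mulmx0 !mul0mx mul1mx mulmx1 !addr0.
- exists (col_mx 0 1%:M), (row_mx 1%:M 0); rewrite /i /p; split.
  + by rewrite mul_row_col mul0mx mul1mx add0r.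
  + by rewrite mul_row_col mul0mx mul1mx addr0.
  + by rewrite mul_row_col mulmx0 mul0mx addr0.
  + rewrite !mul_col_mx !mul_mx_row !mul0mx !mulmx0 mulmx1.
    rewrite add_col_mx !add_row_mx !addr0 !add0r.
    by rewrite -[RHS]/(1%:M : 'M_(dim M + dim M)) scalar_mx_block.
Qed.

Lemma ext_projective (ph : 'M[k]_(dim M)) : tr b ph = 1%:M -> projective ext_mod.
Proof.
move=> ph1; pose z : 'M[k]_(dim ext_mod) := block_mx 0 0 1%:M 1%:M.
pose ph2 : 'M[k]_(dim ext_mod) := block_mx ph 0 0 ph.
have zb : act b z = z.
  rewrite /act /= /ext_gen eqxx !mulmx_block.
  by rewrite !(mulmx0, mul0mx, mulmx1, addr0, add0r) genK.
have z1 : tr (~~ b) z = 1%:M.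
  rewrite /tr /act /= /ext_gen; have -> : (~~ b == b) = false by case: b.
  rewrite !mulmx_block !(mulmx0, mul0mx, mulmx1, addr0, add0r) genK add2r.
  by rewrite add_block_mx !add0r add2r addr0 -scalar_mx_block.
have ph21 : tr b ph2 = 1%:M.
  rewrite /tr /act /= /ext_gen eqxx !mulmx_block.
  rewrite !(mulmx0, mul0mx, addr0, add0r) add_block_mx addr0.
  by rewrite -/(act b ph) -/(tr b ph) ph1 -scalar_mx_block.
exists (ph2 *m z); rewrite (trGE (~~ b)) negbK.
by rewrite [tr b _]trMr // ph21 mul1mx.
Qed.

End SelfExtension.

(** The conclusion says that M is projective on the subgroup of one generator.
    Let Z be the radical of M and C a complement.  Augmentations vanish on Z
    and map C to Z, so they form an indecomposable pencil to which [pencil_even]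
    applies; inverting one of the two maps gives a contraction. *)
Lemma even_contractible M : idem_trivial M -> norm_zero M -> ~~ odd (dim M) ->
  exists b, exists ph : 'M[k]_(dim M), tr b ph = 1%:M.
Proof.
move=> Mt M0 even; pose Z := (aug M true + aug M false)%MS.
pose D := row_base Z; pose C := row_base Z^C%MS.
have DZ : (D :=: Z)%MS := eq_row_base _.
have dims : (\rank Z^C + \rank Z = dim M)%N.
  by rewrite mxrank_compl subnK // rank_leq_row.
have CD : row_free (col_mx C D).
  rewrite /row_free -addsmxE (adds_eqmx (eq_row_base _) DZ) dims.
  by rewrite addsmxC; apply: addsmx_compl_full.
have augZ b : (aug M b <= D)%MS by rewrite DZ; case: b; rewrite (addsmxSl, addsmxSr).
have Daug b : D *m aug M b = 0.
  apply/eqP; rewrite -submx0 (eqmxMr _ DZ) addsmxMr addsmx_sub !submx0.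
  have aug0 c : aug M c *m aug M b == 0.
    have [->|ne_cb] := eqVneq c b; first by rewrite aug_sq.
    by case: (c) (b) ne_cb => [] [] // _; rewrite ?M0 // augC M0.
  by rewrite !aug0.
have /submxP[P CP] : (C *m aug M true <= D)%MS by apply: submx_trans (submxMl _ _) _.
have /submxP[R CR] : (C *m aug M false <= D)%MS by apply: submx_trans (submxMl _ _) _.
have PR_indec : pencil_indec P R.
  apply: (pencil_of_indec dims CD CP (Daug _) CR (Daug _)) => e eX eY ee.
  apply: Mt => //; apply/equiv_comm => b; apply: (@addIr _ e).
  by rewrite -{2}[e]mul1mx -{4}[e]mulmx1 -mulmxDl -mulmxDr; case: b.
have contract b ph : aug M b *m ph + ph *m aug M b = 1%:M ->
    exists c, exists ph : 'M[k]_(dim M), tr c ph = 1%:M.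
  move=> ph1; exists b, (ph *m gen M b).
  rewrite trMr; last by rewrite /act genK mul1mx.
  rewrite trE ph1 -[aug M b *m ph](addrK (ph *m aug M b)) ph1.
  rewrite mulmxBl mul1mx -mulmxA aug_sq mulmx0 subr0 /aug addrCA add2r addr0.
  exact: genK.
rewrite -dims in even.
have [PU|RU] := pencil_even PR_indec even.
  have [ph] := pencil_contraction dims CD CP (Daug _) PU; exact: contract.
have [ph] := pencil_contraction dims CD CR (Daug _) RU; exact: contract.
Qed.

Lemma short_exact_intro M J N (i : 'M[k]_(dim M, dim J)) (p : 'M[k]_(dim J, dim N)) :
  equivariant i -> equivariant p -> row_free i -> row_full p -> i *m p = 0 ->
  (kermx p <= i)%MS -> short_exact i p.
Proof.
move=> iE pE ifree /row_fullP[s sp] ip ker_i; split=> //.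
have /submxP[r rE] : (1%:M - p *m s <= i)%MS.
  apply: submx_trans ker_i; apply/sub_kermxP.
  by rewrite mulmxBl mul1mx -mulmxA sp mulmx1 subrr.
exists r, s; split=> //; last by rewrite -rE subrK.
apply: (row_free_inj ifree).
by rewrite /= -mulmxA -rE mulmxBr mulmx1 mulmxA ip mul0mx subr0 mul1mx.
Qed.

Lemma chi_projective_retract M N (a : 'M[k]_(dim N, dim M)) (b : 'M[k]_(dim M, dim N)) :
  equivariant a -> equivariant b -> a *m b = 1%:M -> chi_projective M -> chi_projective N.
Proof.
move=> aE bE ab [th [th3 [thb th3b th1]]].
exists (fun c => a *m th c *m b), (a *m th3 *m b); split.
- by move=> c; rewrite !actM aE bE thb.
- by rewrite 2!act3M (equiv_act3 aE) (equiv_act3 bE) th3b.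
rewrite ![tr _ (a *m _ *m b)]trMr // ![tr _ (a *m _)]trMl //.
by rewrite -!mulmxDl -!mulmxDr th1 mulmx1.
Qed.

(** By [syzygy_retract], K is a direct summand of A, hence 0 or all of A.  If it
    is 0, then M is isomorphic to Q, which is relatively projective. *)
Lemma syzygy_iso M J0 N J1 A K Q
    (i0 : 'M[k]_(dim M, dim J0)) (p0 : 'M[k]_(dim J0, dim N))
    (i1 : 'M[k]_(dim N, dim J1)) (p1 : 'M[k]_(dim J1, dim A))
    (io : 'M[k]_(dim K, dim Q)) (pi : 'M[k]_(dim Q, dim M))
    (s : bool -> 'M[k]_(dim M, dim Q)) (s3 : 'M[k]_(dim M, dim Q)) :
  short_exact i0 p0 -> projective J0 -> short_exact i1 p1 -> projective J1 ->
  short_exact io pi -> chi_projective Q -> right_minimal pi ->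
  (forall b, act b (s b) = s b) -> (forall b, s b *m pi = 1%:M) ->
  act3 s3 = s3 -> s3 *m pi = 1%:M ->
  idem_trivial A -> ~ chi_projective M ->
  exists f : 'M[k]_(dim K, dim A), exists g : 'M[k]_(dim A, dim K),
  [/\ equivariant f, equivariant g, f *m g = 1%:M & g *m f = 1%:M].
Proof.
move=> ex0 pJ0 ex1 pJ1 exQ rQ pi_min sb spi s3b s3pi At nrM.
have [f [g [fE gE gfU]]] :=
  syzygy_retract ex0 pJ0 ex1 pJ1 exQ rQ pi_min sb spi s3b s3pi.
have gfE : equivariant (invmx (g *m f)) by apply/equiv_inv/equivM.
have gf1 : g *m (f *m invmx (g *m f)) = 1%:M by rewrite mulmxA mulmxV.
have [|||e1] := At (f *m invmx (g *m f) *m g).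
- by do 2!apply: equivM => //.
- by rewrite -!mulmxA (mulmxA g f) (mulmxA (g *m f)) mulmxV // mul1mx.
- move=> e0; case: nrM.
  have K0 : (0 : 'M[k]_(dim K)) = 1%:M.
    rewrite -[RHS]mulmx1 -{1}gf1 -gf1 mulmxA -(mulmxA g) e0.
    by rewrite mulmx0 mul0mx.
  have [ioE piE [ka [sg [_ sgpi _ kapi]]]] := exQ.
  have pisg : pi *m sg = 1%:M.
    by rewrite -kapi -[io]mul1mx -K0 mul0mx mulmx0 add0r.
  apply: (chi_projective_retract _ piE sgpi rQ) => b.
  by rewrite -[LHS]mulmx1 -pisg mulmxA -{1}(piE b) -actM sgpi act1 mul1mx.
by exists g, (f *m invmx (g *m f)); split=> //; apply: equivM.
Qed.

End FourGroupModules.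

(** * Higman's criterion *)
Section Summands.

Variables (k : fieldType) (gT : finGroupType) (G : {group gT}).
Implicit Types M N A B C : representation k G.

Definition intertwines M N (f : 'M[k]_(rdegree M, rdegree N)) :=
  {in G, forall x, M x *m f = f *m N x}.

(** Working with endomorphisms of M that factor through B, instead of summands
    of B, lets a factorization through a direct sum be cut into pieces. *)
Definition factors B M (e : 'M[k]_(rdegree M)) :=
  exists a : hom M B, exists b : hom B M, a *m b = e.

Lemma intertwinesM M N A (f : 'M[k]_(rdegree M, rdegree N))
    (g : 'M[k]_(rdegree N, rdegree A)) :
  intertwines f -> intertwines g -> intertwines (f *m g).
Proof. by move=> fE gE x Gx; rewrite mulmxA fE // -[LHS]mulmxA gE // mulmxA. Qed.

Lemma intertwines_inv M N (f : 'M[k]_(rdegree M, rdegree N)) (g : 'M[k]_(rdegree N, rdegree M)) :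
  intertwines f -> f *m g = 1%:M -> g *m f = 1%:M -> intertwines g.
Proof.
move=> fE fg gf x Gx.
by rewrite -[LHS]mul1mx -gf -mulmxA (mulmxA f) -fE // -!mulmxA fg mulmx1.
Qed.

Lemma rsim_of_inverse M N (f : 'M[k]_(rdegree M, rdegree N)) (g : 'M[k]_(rdegree N, rdegree M)) :
  intertwines f -> f *m g = 1%:M -> g *m f = 1%:M -> mx_rsim M N.
Proof.
move=> fE fg gf; have f_free : row_free f by apply/row_freeP; exists g.
exists f => //; apply/eqP; rewrite eqn_leq -{1}(eqP f_free) rank_leq_col /=.
by rewrite -(mxrank1 k (rdegree N)) -gf (leq_trans (mxrankM_maxl _ _) (rank_leq_col _)).
Qed.

Lemma mulmx1_swap m n (f : 'M[k]_(m, n)) (g : 'M[k]_(n, m)) :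
  m = n -> f *m g = 1%:M -> g *m f = 1%:M.
Proof. by move=> mn; case: _ / mn f g => f g /mulmx1C. Qed.

Lemma direct_summand_factors A M : direct_summand A M <-> factors M (1%:M : 'M_(rdegree A)).
Proof.
split=> [[B] | [a [b ab]]].
  case=> f dimM f_free fE.
  have /row_freeP[g fg] := f_free; have gf : g *m f = 1%:M := mulmx1_swap dimM fg.
  have gE : intertwines g by apply: intertwines_inv fE fg gf.
  have aE : intertwines (row_mx 1%:M 0 *m g : 'M_(rdegree A, rdegree M)).
    apply: (@intertwinesM A (dadd_grepr A B)) => // x Gx /=.
    by rewrite mul_row_block mul_mx_row !mulmx0 !mul0mx mulmx1 mul1mx !addr0.
  have bE : intertwines (f *m col_mx 1%:M 0 : 'M_(rdegree M, rdegree A)).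
    apply: (@intertwinesM _ (dadd_grepr A B)) => // x Gx /=.
    by rewrite mul_block_col mul_col_mx !mulmx0 !mul0mx mulmx1 mul1mx !addr0.
  exists (Hom aE), (Hom bE) => /=.
  by rewrite mulmxA -(mulmxA _ g) gf mulmx1 mul_row_col mul1mx mul0mx addr0.
exists (ker_repr b).
pose p : 'M_(rdegree M) := 1%:M - b *m a.
have pb : p *m b = 0 by rewrite mulmxBl mul1mx -mulmxA ab mulmx1 subrr.
pose io : 'M_(rdegree (ker_repr b), rdegree M) := val_submod 1%:M.
have io_b : io *m b = 0 by apply/sub_kermxP; rewrite val_submod1.
have io_p : io *m p = io by rewrite mulmxBr mulmx1 mulmxA io_b mul0mx subr0.
have p_ker : (p <= kermx b)%MS by apply/sub_kermxP.
pose q : 'M_(rdegree M, rdegree (ker_repr b)) := in_submod (kermx b) p.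
have q_io : q *m io = p by rewrite -val_submodE in_submodK.
have io_q : io *m q = 1%:M.
  apply: (@val_submod_inj _ _ (kermx b)).
  by rewrite [LHS]val_submodE -/io -mulmxA q_io io_p.
have a_p : a *m p = 0 by rewrite mulmxBr mulmx1 mulmxA ab mul1mx subrr.
have a_q : a *m q = 0.
  by apply: (@val_submod_inj _ _ (kermx b)); rewrite linear0 val_submodE -/io -mulmxA q_io.
apply: (@rsim_of_inverse _ (dadd_grepr A (ker_repr b)) (row_mx b q) (col_mx a io)).
- move=> x Gx /=; rewrite mul_mx_row mul_row_block !mulmx0 addr0 add0r.
  congr row_mx; first exact: hom_comm.
  rewrite /q -in_submodJ // in_submodE mulmxA [in RHS]in_submodE; congr (_ *m _).
  rewrite mulmxBl mulmxBr mul1mx mulmx1 mulmxA (hom_comm b) // -mulmxA.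
  by rewrite (hom_comm a) // mulmxA.
- by rewrite mul_row_col q_io addrC subrK.
- by rewrite mul_col_row ab io_b a_q io_q -scalar_mx_block.
Qed.

Lemma factors0 B M : factors B (0 : 'M_(rdegree M)).
Proof.
have zE A C : intertwines (0 : 'M_(rdegree A, rdegree C)).
  by move=> x _; rewrite mulmx0 mul0mx.
by exists (Hom (zE M B)), (Hom (zE B M)); rewrite /= mulmx0.
Qed.

Lemma factors_dadd B C M (e1 e2 : 'M_(rdegree M)) :
  factors B e1 -> factors C e2 -> factors (dadd_grepr B C) (e1 + e2).
Proof.
move=> [a1 [b1 <-]] [a2 [b2 <-]].
have aE : @intertwines M (dadd_grepr B C) (row_mx a1 a2).
  move=> x Gx /=; rewrite mul_mx_row mul_row_block !mulmx0 addr0 add0r.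
  by rewrite !hom_comm.
have bE : @intertwines (dadd_grepr B C) M (col_mx b1 b2).
  move=> x Gx /=; rewrite mul_block_col mul_col_mx !mul0mx addr0 add0r.
  by rewrite !hom_comm.
by exists (Hom aE), (Hom bE); rewrite /= mul_row_col.
Qed.

Lemma dadd_factors B C M (e : 'M_(rdegree M)) : factors (dadd_grepr B C) e ->
  exists e1, exists e2, [/\ e = e1 + e2, factors B e1 & factors C e2].
Proof.
move=> [[a aE] [[b bE] <-]] /=.
pose a1 : 'M_(rdegree M, rdegree B) := lsubmx a.
pose a2 : 'M_(rdegree M, rdegree C) := rsubmx a.
pose b1 : 'M_(rdegree B, rdegree M) := usubmx b.
pose b2 : 'M_(rdegree C, rdegree M) := dsubmx b.
have aD : a = row_mx a1 a2 by rewrite hsubmxK.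
have bD : b = col_mx b1 b2 by rewrite vsubmxK.
have a12E : intertwines a1 /\ intertwines a2.
  have aE' x : x \in G -> row_mx (M x *m a1) (M x *m a2) = row_mx (a1 *m B x) (a2 *m C x).
    move=> Gx; rewrite -mul_mx_row -aD aE // aD mul_row_block !mulmx0.
    by rewrite addr0 add0r.
  by split=> x /aE' /eq_row_mx[].
have b12E : intertwines b1 /\ intertwines b2.
  have bE' x : x \in G -> col_mx (B x *m b1) (C x *m b2) = col_mx (b1 *m M x) (b2 *m M x).
    move=> Gx; rewrite -mul_col_mx -bD -bE // bD mul_block_col !mul0mx.
    by rewrite addr0 add0r.
  by split=> x /bE' /eq_col_mx[].
exists (a1 *m b1), (a2 *m b2); split; first by rewrite aD bD mul_row_col.
- by exists (Hom a12E.1), (Hom b12E.1).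
- by exists (Hom a12E.2), (Hom b12E.2).
Qed.

Lemma factors_big (I : Type) (r : seq I) (P : pred I) (B : I -> representation k G)
    M (e : I -> 'M_(rdegree M)) :
  (forall i, P i -> factors (B i) (e i)) ->
  factors (\big[dadd_grepr/grepr0]_(i <- r | P i) B i) (\sum_(i <- r | P i) e i).
Proof.
move=> eB; elim: r => [|i r IHr]; first by rewrite !big_nil; apply: factors0.
by rewrite !big_cons; case: ifP => // Pi; apply: factors_dadd => //; apply: eB.
Qed.

Lemma big_factors (I : Type) (r : seq I) (P : pred I) (B : I -> representation k G)
    M (S : 'M_(rdegree M) -> Prop) :
  S 0 -> (forall e1 e2, S e1 -> S e2 -> S (e1 + e2)) ->
  (forall i e, P i -> factors (B i) e -> S e) ->
  forall e, factors (\big[dadd_grepr/grepr0]_(i <- r | P i) B i) e -> S e.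
Proof.
move=> S0 SD SB; elim: r => [|i r IHr] e.
  rewrite big_nil => -[a [b <-]].
  by rewrite [hom_mx a]thinmx0 mul0mx.
rewrite big_cons; case: ifP => Pi; last exact: IHr.
case/dadd_factors=> e1 [e2 [-> e1B e2B]].
by apply: SD; [apply: SB e1B | apply: IHr].
Qed.

Section InducedTrace.
Variables (H : subgroup_of G) (M : representation k G).

(** The trace from H to G of an endomorphism of the restriction of M to H. *)
Definition coset_trace (th : 'M[k]_(rdegree M)) :=
  \sum_(i < #|G : val H|) M (coset_rep i)^-1%g *m th *m M (coset_rep i).

Lemma coset_trace_hom (th : 'M[k]_(rdegree M)) :
  {in val H, forall x, M x *m th = th *m M x} ->
  @intertwines M (induced (restriction H M))
     (\mxrow_(j < #|G : val H|) (M (coset_rep j)^-1%g *m th)).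
Proof.
move=> thH x Gx; rewrite mul_mxrow mul_mxrow_mxblock; apply/eq_mxrowP => j /=.
have Gj := (coset_repP j).1.
have [i Hi] : exists i : 'I_#|G : val H|, (coset_rep i * x * (coset_rep j)^-1)%g \in val H.
  have [i Hi] := coset_rep_exists H (groupM Gj (groupVr Gx)).
  by exists i; move: Hi; rewrite -groupV !invMg !invgK mulgA.
rewrite (bigD1 i) //= Hi big1 => [|i' ne_i'].
  have Gi := (coset_repP i).1.
  rewrite addr0 -mulmxA -thH // !mulmxA -!repr_mxM ?groupM ?groupV //.
  by rewrite !mulgA mulVg mul1g.
case: ifP => [Hi'|_]; last by rewrite mulmx0.
case/eqP: ne_i'; apply: coset_rep_inj.
have -> : (coset_rep i' * (coset_rep i)^-1 =
   (coset_rep i' * x * (coset_rep j)^-1) * (coset_rep i * x * (coset_rep j)^-1)^-1)%g.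
  by rewrite !invMg invgK !mulgA mulgKV mulgK.
by rewrite groupM ?groupV.
Qed.

Lemma coset_trace_factors (th : 'M[k]_(rdegree M)) :
  {in val H, forall x, M x *m th = th *m M x} ->
  factors (induced (restriction H M)) (coset_trace th).
Proof.
move=> thH.
have bE : @intertwines (induced (restriction H M)) M
    (\mxcol_(j < #|G : val H|) M (coset_rep j)).
  move=> x Gx; rewrite mxcol_mul mul_mxblock_mxrow; apply/eq_mxcolP => i /=.
  have Gi := (coset_repP i).1.
  have [j Hj] := coset_rep_exists H (groupM Gi Gx).
  rewrite (bigD1 j) //= Hj big1 => [|j' ne_j'].
    have Gj := (coset_repP j).1.
    by rewrite addr0 -!repr_mxM ?groupM ?groupV // mulgKV.
  case: ifP => [Hj'|_]; last by rewrite mul0mx.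
  case/eqP: ne_j'; apply: coset_rep_inj.
  have -> : (coset_rep j' * (coset_rep j)^-1 =
     (coset_rep i * x * (coset_rep j')^-1)^-1
     * (coset_rep i * x * (coset_rep j)^-1))%g.
    by rewrite !invMg invgK -!mulgA !mulKg.
  by rewrite groupM ?groupV.
exists (Hom (coset_trace_hom thH)), (Hom bE) => /=.
by rewrite mul_mxrow_mxcol.
Qed.

(** Both factors are determined by their components at the trivial coset, as
    the group permutes the cosets transitively; th is the product of these two
    components. *)
Lemma factors_coset_trace (e : 'M[k]_(rdegree M)) :
  factors (induced (restriction H M)) e ->
  exists2 th, {in val H, forall x, M x *m th = th *m M x} & e = coset_trace th.
Proof.
move=> [[a aE] [[b bE] <-]] /=.
have HR : (val H : {set gT}) \in rcosets (val H) G.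
  by apply/rcosetsP; exists 1%g; rewrite ?group1 // mulg1.
pose i0 := enum_rank_in HR (val H : {set gT}).
have rep0 : coset_rep i0 = 1%g by rewrite /coset_rep enum_rankK_in // repr_group.
pose a_ j : 'M_(rdegree M) := submxrow a j.
pose b_ j : 'M_(rdegree M) := submxcol b j.
have aD : a = \mxrow_j a_ j by rewrite submxrowK.
have bD : b = \mxcol_j b_ j by rewrite submxcolK.
have a_mul x i j : x \in G -> (coset_rep j * x * (coset_rep i)^-1)%g \in val H ->
    M x *m a_ i = a_ j *m M (coset_rep j * x * (coset_rep i)^-1)%g.
  move=> Gx Hji; have := aE x Gx; rewrite aD mul_mxrow mul_mxrow_mxblock.
  move/eq_mxrowP => /(_ i) -> /=.
  rewrite (bigD1 j) //= Hji big1 ?addr0 // => j' ne_j'.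
  case: ifP => [Hj'|_]; last by rewrite mulmx0.
  case/eqP: ne_j'; apply: coset_rep_inj.
  have -> : (coset_rep j' * (coset_rep j)^-1 =
     (coset_rep j' * x * (coset_rep i)^-1)
     * (coset_rep j * x * (coset_rep i)^-1)^-1)%g.
    by rewrite !invMg invgK !mulgA mulgKV mulgK.
  by rewrite groupM ?groupV.
have b_mul x i j : x \in G -> (coset_rep i * x * (coset_rep j)^-1)%g \in val H ->
    M (coset_rep i * x * (coset_rep j)^-1)%g *m b_ j = b_ i *m M x.
  move=> Gx Hij; have := bE x Gx; rewrite bD mxcol_mul mul_mxblock_mxrow.
  move/eq_mxcolP => /(_ i) <- /=.
  rewrite (bigD1 j) //= Hij big1 ?addr0 // => j' ne_j'.
  case: ifP => [Hj'|_]; last by rewrite mul0mx.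
  case/eqP: ne_j'; apply: coset_rep_inj.
  have -> : (coset_rep j' * (coset_rep j)^-1 =
     (coset_rep i * x * (coset_rep j')^-1)^-1
     * (coset_rep i * x * (coset_rep j)^-1))%g.
    by rewrite !invMg invgK -!mulgA !mulKg.
  by rewrite groupM ?groupV.
exists (a_ i0 *m b_ i0) => [x Hx|].
  have Gx : x \in G := subsetP (valP H) x Hx.
  have x0 : (coset_rep i0 * x * (coset_rep i0)^-1)%g = x.
    by rewrite rep0 mul1g invg1 mulg1.
  have := a_mul x i0 i0 Gx; have := b_mul x i0 i0 Gx; rewrite x0 => bx ax.
  by rewrite mulmxA ax // -!mulmxA bx.
rewrite aD bD mul_mxrow_mxcol; apply: eq_bigr => i _.
have Gi := (coset_repP i).1.
have i1 : (coset_rep i0 * coset_rep i * (coset_rep i)^-1)%g = 1%g.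
  by rewrite rep0 mul1g mulgV.
have := a_mul _ i i0 Gi; have := b_mul _ i0 i Gi.
rewrite i1 repr_mx1 mul1mx mulmx1 => -> // <- //.
rewrite -!mulmxA (mulmxA _ (M _) (a_ i *m _)) -repr_mxM ?groupV //.
by rewrite mulVg repr_mx1 mul1mx.
Qed.

End InducedTrace.
End Summands.

(** * From representations of the four-group to the matrix model *)
Section KleinFour.

Variables (k : fieldType) (gT : finGroupType) (G : {group gT}) (s t : gT).
Hypotheses (char2 : 2 \in [pchar k]) (abelG : (2.-abelem G)%g) (cardG : #|G| = 4).
Hypotheses (Gs : s \in G) (Gt : t \in G) (s_neq1 : s != 1%g) (t_neq1 : t != 1%g)
           (s_neq_t : s != t).
Implicit Types M N J : representation k G.

Lemma klein_sq x : x \in G -> (x * x)%g = 1%g.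
Proof. by move=> Gx; have [_ /(_ x Gx)] := abelemP (isT : prime 2) abelG. Qed.

Lemma klein_inv x : x \in G -> (x^-1)%g = x.
Proof. by move=> Gx; apply/eqP; rewrite eq_invg_mul klein_sq. Qed.

Lemma kleinC x y : x \in G -> y \in G -> (x * y)%g = (y * x)%g.
Proof. by move=> Gx Gy; apply: (centsP (abelem_abelian abelG)). Qed.

Lemma st_neq : [/\ (s * t != 1), (s * t != s) & (s * t != t)]%g.
Proof.
split; first by rewrite -eq_invg_mul klein_inv.
  by rewrite -{2}[s]mulg1 (inj_eq (mulgI s)).
by rewrite -{2}[t]mul1g (inj_eq (mulIg t)).
Qed.

Lemma klein_elements : G = [set 1; s; t; s * t]%g :> {set gT}.
Proof.
have [st1 sts stt] := st_neq; apply/esym/eqP; rewrite eqEcard; apply/andP; split.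
  by apply/subsetP => x; rewrite !inE -!orbA => /or4P[]/eqP->; rewrite ?groupM ?group1.
rewrite cardG -!setUA !cardsU1 cards1 !inE !(eq_sym 1%g) (negPf s_neq1) (negPf t_neq1).
by rewrite (negPf st1) (negPf s_neq_t) !(eq_sym _ (s * t)%g) (negPf sts) (negPf stt).
Qed.

Lemma kleinP x : x \in G -> [\/ x = 1%g, x = s, x = t | x = (s * t)%g].
Proof.
rewrite klein_elements !inE -!orbA => /or4P[] /eqP->;
by [constructor 1 | constructor 2 | constructor 3 | constructor 4].
Qed.

Definition v4gen b := if b then s else t.

Lemma v4gen_in b : v4gen b \in G. Proof. by case: b. Qed.

Lemma of_reprK M b : M (v4gen b) *m M (v4gen b) = 1%:M.
Proof. by rewrite -repr_mxM ?v4gen_in // klein_sq ?v4gen_in // repr_mx1. Qed.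

Lemma of_reprC M b c : M (v4gen b) *m M (v4gen c) = M (v4gen c) *m M (v4gen b).
Proof. by rewrite -!repr_mxM ?v4gen_in // kleinC ?v4gen_in. Qed.

Definition of_repr M : v4mod k := V4Mod (of_reprK M) (of_reprC M).

Lemma intertwines_equivariant M N (f : 'M[k]_(rdegree M, rdegree N)) :
  intertwines f <-> @equivariant _ (of_repr M) (of_repr N) f.
Proof.
split=> [fE | /equiv_comm fE x /kleinP[] ->].
- by apply/equiv_comm => b; apply/fE/v4gen_in.
- by rewrite !repr_mx1 mul1mx mulmx1.
- exact: (fE true).
- exact: (fE false).
- rewrite !repr_mxM // -mulmxA [M t *m f](fE false) mulmxA [M s *m f](fE true).
  by rewrite -mulmxA.
Qed.

Lemma hom_equivariant M N (f : hom M N) : @equivariant _ (of_repr M) (of_repr N) f.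
Proof. by apply/intertwines_equivariant => x Gx; apply: hom_comm. Qed.

Lemma act_repr M N b (f : 'M[k]_(rdegree M, rdegree N)) :
  @act _ (of_repr M) (of_repr N) b f = M (v4gen b) *m f *m N (v4gen b).
Proof. by []. Qed.

Lemma act3_repr M N (f : 'M[k]_(rdegree M, rdegree N)) :
  @act3 _ (of_repr M) (of_repr N) f = M (s * t)%g *m f *m N (s * t)%g.
Proof. by rewrite /act3 !act_repr repr_mxM // [in RHS]kleinC // repr_mxM // !mulmxA. Qed.

Section Order2.
Variables (H : subgroup_of G) (M : representation k G).
Hypothesis H2 : #|val H| = 2.

Lemma order2_set x : x \in val H -> x != 1%g -> val H = [set 1%g; x] :> {set gT}.
Proof.
move=> Hx x1; apply/esym/eqP; rewrite eqEcard H2 cards2 eq_sym x1 andbT.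
by apply/subsetP => y; rewrite !inE => /orP[]/eqP->.
Qed.

Lemma coset_trace_order2 y (th : 'M[k]_(rdegree M)) : y \in G -> y \notin val H ->
  {in val H, forall x, M x *m th = th *m M x} ->
  coset_trace H th = th + M y *m th *m M y.
Proof.
move=> Gy Hy thH; pose F x := M x^-1%g *m th *m M x.
have Fr x : x \in G -> F (repr (val H :* x)) = F x.
  move=> Gx; have [h Hh] := repr_rcosetP (val H) x.
  have Gh := subsetP (valP H) h Hh.
  rewrite /F invMg !repr_mxM ?groupV // -!mulmxA (mulmxA th) -thH //.
  by rewrite (mulmxA (M h^-1)%g) (mulmxA (M h^-1)%g) -repr_mxM ?groupV // mulVg repr_mx1 mul1mx.
have HR x : x \in G -> val H :* x \in rcosets (val H) G.
  by move=> Gx; apply/rcosetsP; exists x.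
have neqH : val H :* 1 != val H :* y.
  by apply: contra Hy => /eqP/rcoset_eqP; rewrite mem_rcoset mul1g groupV.
have index2 : #|G : val H| = 2.
  by apply/eqP; rewrite -(eqn_pmul2l (cardG_gt0 (val H))) Lagrange ?(valP H) // H2 cardG.
have cosets : rcosets (val H) G = [set val H :* 1; val H :* y].
  apply/esym/eqP; rewrite eqEcard [#|rcosets _ _|]index2 cards2 neqH andbT.
  by apply/subsetP => C; rewrite !inE => /orP[]/eqP->; apply: HR.
rewrite /coset_trace -[LHS]/(\sum_(i < #|rcosets (val H) G|) F (repr (enum_val i))).
rewrite -(big_enum_val (fun C : {set gT} => F (repr C))) cosets big_setU1 ?inE //=.
rewrite big_set1 !Fr // /F invg1 repr_mx1 mul1mx mulmx1.
by rewrite klein_inv.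
Qed.

End Order2.

Lemma order2_unique H x : H \in subgroups_of_order2 G -> x \in val H -> x != 1%g ->
  forall K, K \in subgroups_of_order2 G -> x \in val K -> K = H.
Proof.
rewrite inE => /eqP H2 Hx x1 K; rewrite inE => /eqP K2 Kx.
by apply/val_inj/group_inj; rewrite /= (order2_set H2 Hx x1) (order2_set K2 Kx x1).
Qed.

Lemma cyclic_order2 x : x \in G -> x != 1%g ->
  exists2 H : subgroup_of G, H \in subgroups_of_order2 G & x \in val H.
Proof.
move=> Gx x1; have sG : <[x]>%G \subset G by rewrite cycle_subG.
exists (exist _ <[x]>%G sG); last exact: cycle_id.
by rewrite inE /= -orderE (@nt_prime_order _ 2) // expgS expg1 klein_sq.
Qed.

Lemma commutes_act M b (th : 'M[k]_(rdegree M)) (H : subgroup_of G) :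
  v4gen b \in val H -> {in val H, forall x, M x *m th = th *m M x} ->
  @act _ (of_repr M) (of_repr M) b th = th.
Proof. by move=> Hb thH; rewrite act_repr thH // -mulmxA of_reprK mulmx1. Qed.

Lemma act_commutes M (th : 'M[k]_(rdegree M)) x :
  x \in G -> M x *m th *m M x = th -> M x *m th = th *m M x.
Proof.
move=> Gx thE; rewrite -[in RHS]thE -[RHS]mulmxA -repr_mxM // klein_sq //.
by rewrite repr_mx1 mulmx1.
Qed.

Lemma order2_cases H : H \in subgroups_of_order2 G ->
  [\/ s \in val H /\ t \notin val H, t \in val H /\ s \notin val H
    | (s * t)%g \in val H /\ s \notin val H].
Proof.
have [st1 sts stt] := st_neq.
rewrite inE => /eqP H2; have [Hs|nHs] := boolP (s \in val H).
  constructor 1; split=> //; rewrite (order2_set H2 Hs s_neq1) !inE.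
  by rewrite (negPf t_neq1) eq_sym.
have [Ht|nHt] := boolP (t \in val H); first by constructor 2.
constructor 3; split=> //; apply/idPn => nHst.
have : val H \subset [set 1%g].
  apply/subsetP => x Hx; rewrite inE.
  have [->|e|e|e] := kleinP (subsetP (valP H) x Hx); rewrite ?eqxx //.
  - by rewrite -e Hx in nHs.
  - by rewrite -e Hx in nHt.
  - by rewrite -e Hx in nHst.
by move/subset_leq_card; rewrite H2 cards1.
Qed.

(** Factoring the identity through the sum of the induced modules amounts to
    writing it as a sum of traces, one from each subgroup of order 2. *)
Lemma rel_projective_chi_projective M :
  rel_projective (subgroups_of_order2 G) M <-> chi_projective (of_repr M).
Proof.
pose S (e : 'M[k]_(rdegree M)) := exists th : bool -> 'M[k]_(dim (of_repr M)), exists th3,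
  [/\ forall b, act b (th b) = th b, act3 th3 = th3 &
      tr false (th true) + tr true (th false) + tr true th3 = e].
split=> [/direct_summand_factors|[th [th3 [thb th3b th1]]]].
  apply: (@big_factors _ _ _ _ _ _ _ _ S).
  - exists (fun=> 0), 0; split; first by move=> b; rewrite act0.
      by rewrite /act3 !act0.
    by rewrite /tr !act0 !addr0.
  - move=> e1 e2 [th [th3 [thb th3b <-]]] [th' [th3' [thb' th3b' <-]]].
    exists (fun b => th b + th' b), (th3 + th3'); split.
    + by move=> b; rewrite actD thb thb'.
    + by rewrite act3D th3b th3b'.
    + by rewrite !trD [X in X + _ = _]addrACA [LHS]addrACA.
  - move=> H e chiH /factors_coset_trace[th thH ->].
    have H2 : #|val H| = 2 by move: chiH; rewrite inE => /eqP.
    have [[Hs nHt]|[Ht nHs]|[Hst nHs]] := order2_cases chiH.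
    + rewrite (coset_trace_order2 H2 Gt nHt thH).
      exists (fun b => if b then th else 0), 0; split.
      * by case; rewrite ?act0 // (commutes_act (b := true) Hs).
      * by rewrite /act3 !act0.
      * by rewrite /tr !act0 !addr0.
    + rewrite (coset_trace_order2 H2 Gs nHs thH).
      exists (fun b => if b then 0 else th), 0; split.
      * by case; rewrite ?act0 // (commutes_act (b := false) Ht).
      * by rewrite /act3 !act0.
      * by rewrite /tr !act0 !addr0 add0r.
    + rewrite (coset_trace_order2 H2 Gs nHs thH).
      exists (fun=> 0), th; split.
      * by move=> b; rewrite act0.
      * by rewrite act3_repr thH // -mulmxA -repr_mxM ?groupM // klein_sq ?groupM // repr_mx1 mulmx1.
      * by rewrite /tr !act0 !addr0 add0r.
apply/direct_summand_factors.
pose tt (H : subgroup_of G) : 'M[k]_(rdegree M) :=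
  if s \in val H then th true else if t \in val H then th false else th3.
have tt_comm H : H \in subgroups_of_order2 G ->
    {in val H, forall x, M x *m tt H = tt H *m M x}.
  move=> chiH; have H2 : #|val H| = 2 by move: chiH; rewrite inE => /eqP.
  have [st1 sts stt] := st_neq.
  have comm1 y : y \in val H -> y != 1%g -> M y *m tt H *m M y = tt H ->
      {in val H, forall x, M x *m tt H = tt H *m M x}.
    move=> Hy y1 yE x; rewrite (order2_set H2 Hy y1) !inE => /orP[]/eqP->.
      by rewrite !repr_mx1 mul1mx mulmx1.
    by apply: act_commutes => //; apply: (subsetP (valP H)).
  have [[Hs nHt]|[Ht nHs]|[Hst nHs]] := order2_cases chiH.
  - by apply: (comm1 s) => //; rewrite /tt Hs; apply: (thb true).
  - by apply: (comm1 t) => //; rewrite /tt (negPf nHs) Ht; apply: (thb false).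
  - apply: (comm1 (s * t)%g) => //; rewrite /tt (negPf nHs) ifN.
      by rewrite -act3_repr.
    apply: contra nHs => Ht; have := groupM Hst Ht.
    by rewrite -mulgA klein_sq // mulg1.
have [Hs chis Hss] := cyclic_order2 Gs s_neq1.
have [Ht chit Htt] := cyclic_order2 Gt t_neq1.
have [Hst chist Hstst] := cyclic_order2 (groupM Gs Gt) (let: And3 h _ _ := st_neq in h).
move: (chis) (chit) (chist); rewrite !inE => /eqP s2 /eqP t2 /eqP st2.
have [st1 sts stt] := st_neq.
have nst : t \notin val Hs.
  by rewrite (order2_set s2 Hss s_neq1) !inE negb_or t_neq1 eq_sym.
have nts : s \notin val Ht by rewrite (order2_set t2 Htt t_neq1) !inE negb_or s_neq1.
have nsst : s \notin val Hst.
  by rewrite (order2_set st2 Hstst st1) !inE negb_or s_neq1 eq_sym.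
have ntst : t \notin val Hst.
  by rewrite (order2_set st2 Hstst st1) !inE negb_or t_neq1 eq_sym.
have sum1 : \sum_(H in subgroups_of_order2 G) coset_trace H (tt H) = 1%:M.
  rewrite (bigD1 Hs) //= (bigD1 Ht) /=; last first.
    by rewrite chit; apply: contraNneq nts => ->.
  rewrite (bigD1 Hst) /=; last first.
    by rewrite chist; apply/andP; split; [apply: contraNneq nsst => -> | apply: contraNneq ntst => ->].
  rewrite big1 ?addr0; last first.
    move=> H /andP[/andP[/andP[chiH neq_s] neq_t] neq_st].
    have [[h _]|[h _]|[h _]] := order2_cases chiH.
    - by case/eqP: neq_s; apply: (order2_unique chis Hss s_neq1).
    - by case/eqP: neq_t; apply: (order2_unique chit Htt t_neq1).
    - by case/eqP: neq_st; apply: (order2_unique chist Hstst).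
  rewrite (coset_trace_order2 s2 Gt nst (tt_comm _ chis)).
  rewrite (coset_trace_order2 t2 Gs nts (tt_comm _ chit)).
  rewrite (coset_trace_order2 st2 Gs nsst (tt_comm _ chist)).
  rewrite /tt Hss (negPf nts) Htt (negPf nsst) (negPf ntst).
  by rewrite addrA; apply: th1.
rewrite -sum1; apply: factors_big => H chiH.
by apply: coset_trace_factors; apply: tt_comm.
Qed.

(** An injective module is a summand of the module induced from its restriction
    to the trivial subgroup, in which it embeds; so its identity is a trace. *)
Lemma injective_projective J : injective_module J -> projective (of_repr J).
Proof.
move=> injJ; pose H1 : subgroup_of G := exist _ 1%G (sub1G G).
have aE : @intertwines _ _ _ J (induced (restriction H1 J))
    (\mxrow_(j < #|G : val H1|) (J (coset_rep j)^-1%g *m 1%:M)).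
  by apply: coset_trace_hom => x _; rewrite mulmx1 mul1mx.
have [i0 _] := coset_rep_exists H1 (group1 G).
have a_free : row_free (Hom aE).
  apply/row_freeP; exists (\mxcol_j (if j == i0 then J (coset_rep j) else 0)).
  rewrite /= mul_mxrow_mxcol (bigD1 i0) //= eqxx big1 => [|j /negPf->]; last by rewrite mulmx0.
  have Gi := (coset_repP i0).1.
  by rewrite mulmx1 addr0 -repr_mxM ?groupV // mulVg repr_mx1.
have idE : intertwines (1%:M : 'M_(rdegree J)).
  by move=> x _; rewrite mulmx1 mul1mx.
have [b ab] := injJ _ _ (Hom aE) (Hom idE) a_free.
have [|th _] := @factors_coset_trace _ _ _ H1 J 1%:M; first by exists (Hom aE), b.
have [st1 sts stt] := st_neq.
pose F x := J x^-1%g *m th *m J x.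
rewrite /coset_trace -[RHS]/(\sum_(i < #|rcosets (val H1) G|) F (repr (enum_val i))).
rewrite -(big_enum_val (fun C : {set gT} => F (repr C))) /rcosets.
have rc1 x : rcoset (val H1) x = [set x] by rewrite rcosetE /= mul1g.
rewrite big_imset /=; last by move=> x y _ _; rewrite !rc1 => /set1_inj.
under eq_bigr => x _ do rewrite rc1 repr_set1.
rewrite klein_elements -!setUA.
rewrite !big_setU1 /= ?big_set1; last first.
- by rewrite !inE !(eq_sym 1%g) !negb_or s_neq1 t_neq1.
- by rewrite !inE negb_or s_neq_t eq_sym.
- by rewrite !inE eq_sym.
rewrite /F !klein_inv ?groupM ?group1 // repr_mx1 mul1mx mulmx1 => th1.
exists th; apply: etrans (esym th1).
rewrite -act3_repr /trG [tr true _]/tr /tr actD /act3 !act_repr /=.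
by rewrite -addrA; congr (_ + _); rewrite addrCA.
Qed.

(** The image of an idempotent endomorphism as a representation, with the
    inclusion and the projection. *)
Section Image.
Variables (M : representation k G) (e : 'M[k]_(rdegree M)).
Hypotheses (eE : intertwines e) (ee : e *m e = e).

Definition im_repr := Representation (submod_repr (im_module (Hom eE))).
Definition im_in : 'M[k]_(rdegree im_repr, rdegree M) := val_submod 1%:M.
Definition im_proj : 'M[k]_(rdegree M, rdegree im_repr) := in_submod _ e.

Lemma im_proj_in : im_proj *m im_in = e.
Proof. by rewrite /im_in -val_submodE in_submodK // genmxE. Qed.

Lemma im_in_e : im_in *m e = im_in.
Proof.
have /submxP[z zE] : (im_in <= e)%MS by rewrite val_submod1 genmxE.
by rewrite zE -mulmxA ee.
Qed.

Lemma im_in_proj : im_in *m im_proj = 1%:M.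
Proof.
apply: (@val_submod_inj _ _ <<e>>%MS).
by rewrite val_submodE -mulmxA im_proj_in im_in_e.
Qed.

Lemma im_in_intertwines : @intertwines _ _ _ im_repr M im_in.
Proof.
move=> x Gx; rewrite /im_in -val_submodE -[im_repr x]mul1mx.
exact: val_submodJ.
Qed.

Lemma im_proj_intertwines : @intertwines _ _ _ M im_repr im_proj.
Proof.
move=> x Gx; apply: (@val_submod_inj _ _ <<e>>%MS).
have val_in m (W : 'M_(m, _)) : val_submod W = W *m im_in := val_submodE W.
rewrite !val_in -[M x *m _ *m _]mulmxA -[im_proj *m _ *m _]mulmxA im_proj_in.
by rewrite im_in_intertwines // mulmxA im_proj_in eE.
Qed.

End Image.

Lemma indecomposable_idem_trivial M : indecomposable M -> idem_trivial (of_repr M).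
Proof.
move=> [_ indec] e /intertwines_equivariant eE ee.
have : direct_summand (im_repr eE) M.
  apply/direct_summand_factors.
  exists (Hom (im_in_intertwines eE)), (Hom (im_proj_intertwines eE)).
  exact: im_in_proj.
case=> B simM; have [/= r0|B0] := indec _ _ simM.
  by left; apply/eqP; rewrite -mxrank_eq0; rewrite genmxE in r0; apply/eqP.
right; have /= dimM := mxrank_rsim simM; rewrite B0 addn0 genmxE in dimM.
have eU : e \in unitmx.
  by rewrite -row_free_unit /row_free -dimM.
by rewrite -[LHS](mulKmx eU) ee mulVmx.
Qed.

Lemma rsim_of_equivariant M N (f : 'M[k]_(rdegree M, rdegree N)) (g : 'M[k]_(rdegree N, rdegree M)) :
  @equivariant _ (of_repr M) (of_repr N) f -> f *m g = 1%:M -> g *m f = 1%:M ->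
  mx_rsim M N.
Proof. by move=> /intertwines_equivariant; apply: rsim_of_inverse. Qed.

Lemma cosyzygy_exact M (J : injective_hull M) :
  exists p, @short_exact _ (of_repr M) (of_repr (hull J)) (of_repr (cosyzygy J))
              (hull_map J) p.
Proof.
pose U := <<hull_map J>>%MS.
pose p : 'M_(rdegree (hull J), rdegree (cosyzygy J)) := in_factmod U 1%:M.
have pE : @intertwines _ _ _ (hull J) (cosyzygy J) p.
  move=> x Gx; rewrite /p -in_factmodE -[hull J x]mul1mx.
  exact: (in_factmodJ (im_module (hull_map J))).
exists p; apply: short_exact_intro => //=.
- exact: hom_equivariant.
- exact/intertwines_equivariant.
- exact: hull_map_inj.
- apply/row_fullP; exists (val_factmod 1%:M).
  by rewrite -in_factmodE val_factmodK.
- by apply/eqP; rewrite -in_factmodE in_factmod_eq0 genmxE.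
- rewrite -(genmxE (hull_map J)) -in_factmod_eq0 in_factmodE.
  by rewrite mulmx_ker.
Qed.

(** The sum of the group elements maps the hull to its fixed points.  A fixed
    vector spans a submodule, which meets M by essentiality, so it lies in M. *)
Lemma cosyzygy_norm_zero M (J : injective_hull M) : norm_zero (of_repr (cosyzygy J)).
Proof.
have [p ex] := cosyzygy_exact J; have [iE pE [r [sc [_ _ ip _]]]] := ex.
pose X b := aug (of_repr (hull J)) b.
have Xsub : (X true *m X false <= hull_map J)%MS.
  apply/row_subP => l; set u := row l _.
  have [->|u_neq0] := eqVneq u 0; first exact: sub0mx.
  have ub b : u *m hull J (v4gen b) = u.
    apply: (addr2_eq0 char2); rewrite -{2}[u]mulmx1 -mulmxDr -[_ + _]/(X b) -row_mul.
    have -> : X true *m X false *m X b = 0.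
      by case: b; rewrite -mulmxA ?(aug_sq char2) ?mulmx0 // [X false *m _]augC mulmxA (aug_sq char2) mul0mx.
    by rewrite row0.
  have uU : mxmodule (hull J) <<u>>%MS.
    apply/mxmoduleP => x Gx; rewrite (eqmxMr _ (genmxE u)) genmxE.
    have [->|->|->|->] := kleinP Gx; rewrite ?repr_mx1 ?mulmx1 //.
    - by rewrite (ub true).
    - by rewrite (ub false).
    - by rewrite repr_mxM // mulmxA (ub true) (ub false).
  have := hull_essential uU; rewrite -mxrank_eq0 genmxE mxrank_eq0.
  move/(_ u_neq0); rewrite -mxrank_eq0 => rk.
  have capU : (<<u>> <= <<u>> :&: hull_map J)%MS.
    rewrite -(mxrank_leqif_sup (capmxSl _ _)) eqn_leq mxrankS ?capmxSl //= genmxE.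
    by apply: leq_trans (rank_leq_row u) _; rewrite lt0n.
  by rewrite -(genmxE u); apply: submx_trans capU (capmxSr _ _).
apply: (ses_epi ex); rewrite mulmx0.
have pX b : p *m aug (of_repr (cosyzygy J)) b = X b *m p.
  by rewrite /X /aug mulmxDl mulmxDr mulmx1 mul1mx (equiv_comm p).1.
rewrite mulmxA pX -mulmxA pX mulmxA; have /submxP[z ->] := Xsub.
by rewrite -mulmxA ip mulmx0.
Qed.

Lemma rel_syzygy_exact M (Q : rel_projective_cover (subgroups_of_order2 G) M) :
  exists io, @short_exact _ (of_repr (rel_syzygy Q)) (of_repr (cover Q)) (of_repr M)
              io (cover_map Q).
Proof.
pose io : 'M_(rdegree (rel_syzygy Q), rdegree (cover Q)) := val_submod 1%:M.
have ioE : @intertwines _ _ _ (rel_syzygy Q) (cover Q) io.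
  move=> x Gx; rewrite /io -val_submodE -[rel_syzygy Q x]mul1mx.
  exact: val_submodJ.
exists io; apply: short_exact_intro => //=.
- exact/intertwines_equivariant.
- exact: hom_equivariant.
- by rewrite /row_free val_submod1.
- exact: cover_surjective.
- by apply/sub_kermxP; rewrite val_submod1.
- by rewrite val_submod1.
Qed.

(** Otherwise the image of e would be a smaller cover. *)
Lemma cover_right_minimal M (Q : rel_projective_cover (subgroups_of_order2 G) M) :
  @right_minimal _ (of_repr (cover Q)) (of_repr M) (cover_map Q).
Proof.
move=> e /intertwines_equivariant eE ee epi.
pose I := im_repr eE; pose f : 'M_(rdegree I, rdegree M) := im_in eE *m cover_map Q.
have fE : intertwines f.
  by apply: intertwinesM (im_in_intertwines eE) _ => x Gx; apply: hom_comm.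
have proj_f : im_proj eE *m f = cover_map Q by rewrite mulmxA im_proj_in.
have relI : rel_projective (subgroups_of_order2 G) I.
  apply/rel_projective_chi_projective.
  apply: (@chi_projective_retract _ (of_repr (cover Q)) (of_repr I) (im_in eE) (im_proj eE)).
  - exact/intertwines_equivariant/im_in_intertwines.
  - exact/intertwines_equivariant/im_proj_intertwines.
  - exact: im_in_proj.
  - exact/rel_projective_chi_projective/cover_projective.
have fullf : row_full (Hom fE).
  have /row_fullP[z zQ] := cover_surjective Q.
  by apply/row_fullP; exists (z *m im_proj eE); rewrite -mulmxA proj_f.
have splitf : rel_split (subgroups_of_order2 G) (Hom fE).
  move=> H chiH; have [z zQ] := cover_split Q chiH.
  have zE : @intertwines _ _ _ (restriction H M) (restriction H I) (z *m im_proj eE).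
    move=> x Hx; rewrite mulmxA (hom_comm z Hx) -[LHS]mulmxA -[RHS]mulmxA.
    congr (_ *m _); apply: (im_proj_intertwines eE).
    exact: (subsetP (valP H)).
  by exists (Hom zE); rewrite /= -mulmxA proj_f.
have := cover_minimal Q relI fullf splitf; rewrite /= genmxE => rk.
have eU : e \in unitmx by rewrite -row_full_unit /row_full eqn_leq rank_leq_col.
by rewrite -[LHS](mulKmx eU) ee mulVmx.
Qed.

Lemma cover_section M (Q : rel_projective_cover (subgroups_of_order2 G) M) x :
  x \in G -> x != 1%g -> exists z : 'M_(rdegree M, rdegree (cover Q)),
    M x *m z *m cover Q x = z /\ z *m cover_map Q = 1%:M.
Proof.
move=> Gx x1; have [H chiH Hx] := cyclic_order2 Gx x1.
have [z zQ] := cover_split Q chiH; exists z; split=> //.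
rewrite [M x *m _](hom_comm z Hx) -mulmxA -[RHS]mulmx1; congr (_ *m _).
by rewrite /= -repr_mxM // klein_sq // repr_mx1.
Qed.

Lemma rel_syzygy_rsim M (Q : rel_projective_cover (subgroups_of_order2 G) M)
    (A : representation k G) (J0 N J1 : v4mod k)
    (i0 : 'M[k]_(dim (of_repr M), dim J0)) (p0 : 'M[k]_(dim J0, dim N))
    (i1 : 'M[k]_(dim N, dim J1)) (p1 : 'M[k]_(dim J1, dim (of_repr A))) :
  short_exact i0 p0 -> projective J0 -> short_exact i1 p1 -> projective J1 ->
  idem_trivial (of_repr A) -> ~ rel_projective (subgroups_of_order2 G) M ->
  mx_rsim (rel_syzygy Q) A.
Proof.
move=> ex0 pJ0 ex1 pJ1 At nrM; have [io exQ] := rel_syzygy_exact Q.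
have [zs [zsE zsQ]] := cover_section Q Gs s_neq1.
have [zt [ztE ztQ]] := cover_section Q Gt t_neq1.
have [|z3 [z3E z3Q]] := cover_section Q (groupM Gs Gt); first by case: st_neq.
pose z b : 'M_(dim (of_repr M), dim (of_repr (cover Q))) := if b then zs else zt.
have zE b : act b (z b) = z b by case: b; rewrite act_repr.
have zQ b : z b *m cover_map Q = 1%:M by case: b.
have relQ : chi_projective (of_repr (cover Q)) by apply/rel_projective_chi_projective/cover_projective.
have z3E' : @act3 _ (of_repr M) (of_repr (cover Q)) z3 = z3 by rewrite act3_repr.
have nM : ~ chi_projective (of_repr M) by move/rel_projective_chi_projective.
have [f [g [fE _ fg gf]]] := syzygy_iso char2 ex0 pJ0 ex1 pJ1 exQ relQ
  (@cover_right_minimal _ Q) zE zQ z3E' z3Q At nM.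
exact: rsim_of_equivariant fE fg gf.
Qed.

(** In odd dimension the two injective hulls compute a second cosyzygy; in even
    dimension the self-extension [ext_mod], used twice, shows that M is its own
    second cosyzygy. *)
Lemma klein_rel_syzygy M (indecM : indecomposable M)
    (nprojM : ~ rel_projective (subgroups_of_order2 G) M)
    (Q : rel_projective_cover (subgroups_of_order2 G) M) :
  (odd (rdegree M) ->
     forall (J1 : injective_hull M) (J2 : injective_hull (cosyzygy J1)),
     mx_rsim (rel_syzygy Q) (cosyzygy J2)) /\
  (~~ odd (rdegree M) -> mx_rsim (rel_syzygy Q) M).
Proof.
have Mt := indecomposable_idem_trivial indecM.
have M0 : norm_zero (of_repr M).
  apply: (nonprojective_norm_zero char2 Mt) => /projective_chi_projective.
  by move/rel_projective_chi_projective.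
split=> [_ J1 J2 | even].
  have [p1 ex1] := cosyzygy_exact J1; have [p2 ex2] := cosyzygy_exact J2.
  have pJ1 := injective_projective (@hull_injective _ _ _ _ J1).
  have pJ2 := injective_projective (@hull_injective _ _ _ _ J2).
  have N1 := cosyzygy_norm_zero J1; have N2 := cosyzygy_norm_zero J2.
  apply: (rel_syzygy_rsim Q ex1 pJ1 ex2 pJ2) => //.
  apply: (idem_trivial_cosyzygy char2 ex2) => //.
  exact: (idem_trivial_cosyzygy char2 ex1).
have [b [ph ph1]] := even_contractible char2 Mt M0 even.
have ex := ext_exact char2 (of_repr M) b.
have pE := ext_projective char2 ph1.
exact: (rel_syzygy_rsim Q ex pE ex pE).
Qed.

End KleinFour.

Theorem theorem1 (gT : finGroupType) (G : {group gT})
    (abelG : (2.-abelem G)%g) (cardG : #|G| = 4)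
    (k : fieldType) (char2 : 2 \in [pchar k]%R)
    (M : representation k G) (indecM : indecomposable M)
    (nprojM : ~ rel_projective (subgroups_of_order2 G) M)
    (Q : rel_projective_cover (subgroups_of_order2 G) M) :
  (odd (rdegree M) ->
     forall (J1 : injective_hull M) (J2 : injective_hull (cosyzygy J1)),
     mx_rsim (rel_syzygy Q) (cosyzygy J2)) /\
  (~~ odd (rdegree M) -> mx_rsim (rel_syzygy Q) M).
Proof.
have [s Gs s1] : exists2 s, s \in G & s != 1%g.
  by apply/trivgPn; rewrite trivg_card1 cardG.
have [t] : exists2 t, t \in G & t \notin [set 1%g; s].
  apply/subsetPn/negP => /subset_leq_card.
  by rewrite cardG cards2; case: (_ != _).
rewrite !inE negb_or eq_sym => Gt /andP[t1 st].
rewrite eq_sym in t1; rewrite eq_sym in st.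
exact: (klein_rel_syzygy char2 abelG cardG Gs Gt).
Qed.
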